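(* Let $\{X(t),\,-\infty<t<\infty\}$ be a real-valued, zero mean, mean square continuous, wide sense stationary stochastic process with covariance function $C(\cdot)$ and spectral density $\phi(\cdot)$, and let $\widehat{\phi}_n(\cdot)$ be the estimator of $\phi(\cdot)$ defined in the context from a kernel $K$, window widths $b_n>0$ and sampling rates $\rho_n>0$. Suppose that: (1) the function $h_0(t)=\sup_{s\ge|t|}|C(s)|$ is integrable over the real line; (2) $K(\cdot)$ is continuous, even, square integrable and bounded (in absolute value) by a non-negative, even and integrable function having a unique maximum at $0$; further, $K(0)=1$; (3) $b_n\to0$ and $nb_n\to\infty$ as $n\to\infty$; (4) $\rho_n\to\infty$ and $\rho_nb_n\to0$ as $n\to\infty$; (5) the fourth moment $E|X(t)|^4$ exists for every $t$, the fourth moment function $E[X(t)X(t+v_1)X(t+v_2)X(t+v_3)]$ is a function only of the lags $v_1,v_2,v_3$, and the fourth order cumulant function $Q(v_1,v_2,v_3)$ (defined in the context) satisfies $|Q(v_1,v_2,v_3)|\le\prod_{i=1}^3g_i(v_i)$, where $g_1,g_2,g_3$ are continuous, even, nonnegative and integrable functions over the real line which are non-increasing over $[0,\infty)$. Then $$\lim_{n\to\infty}nb_n\,Var[\widehat{\phi}_n(\lambda)]=(1+\delta_{0,\lambda})[\phi(\lambda)]^2\int_{-\infty}^\infty K^2(x)\,dx,$$ where $\delta_{0,\lambda}$ is $1$ if $\lambda=0$ and is $0$ otherwise. The convergence is uniform in $\lambda$ over any closed and finite interval that does not include the frequency $0$. In particular, $Var[\widehat{\phi}_n(\lambda)]$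 converges to $0$.
   Context: The covariance function is $C(t)=E[X(s)X(s+t)]$ and the spectral density is $\phi(\lambda)=\frac1{2\pi}\int_{-\infty}^\infty C(t)e^{-it\lambda}\,dt$. The process is sampled uniformly at rate $\rho_n$, the sample size being $n$. The estimator is $$\widehat{\phi}_n(\lambda)=\frac{1}{2\pi\rho_n}\sum_{|v|<n}\widehat{\gamma}_n(v)K(b_nv)e^{-\frac{iv\lambda}{\rho_n}}\,1_{[-\pi\rho_n,\pi\rho_n]}(\lambda),$$ where $v$ ranges over integers, $1_A$ is the indicator function of $A$, and $$\widehat{\gamma}_n(v)=\frac1n\sum_{j=1}^{n-|v|}X\left(\frac{j}{\rho_n}\right)X\left(\frac{j+|v|}{\rho_n}\right),\qquad |v|\le n-1.$$ The fourth order cumulant function is $Q(v_1,v_2,v_3)=P(v_1,v_2,v_3)-P_G(v_1,v_2,v_3)$, where $P(v_1,v_2,v_3)=E[X(t)X(t+v_1)X(t+v_2)X(t+v_3)]$ and $P_G(v_1,v_2,v_3)=C(v_1)C(v_3-v_2)+C(v_2)C(v_3-v_1)+C(v_3)C(v_1-v_2)$.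
   Formalization: The integrable function bounding |K| is taken to be non-increasing on [0,∞) as well as having its strict maximum at 0; with only a unique global maximum at 0 the claim fails (Gaussian X, C(t)=exp(-|t|), K with thin spikes of height 1/2 at the nonzero integers). *)

(* Defs.v *)
From HB Require Import structures.
From mathcomp Require Import all_boot all_order all_algebra.
From mathcomp Require Import all_classical all_reals all_analysis measurable_realfun.
From mathcomp Require Export complex.

Set Implicit Arguments.
Unset Strict Implicit.
Unset Printing Implicit Defensive.
Import Order.TTheory GRing.Theory Num.Theory.
Import numFieldNormedType.Exports.
Local Open Scope classical_set_scope.
Local Open Scope ring_scope.
Local Open Scope complex_scope.

Section Process.
Context d (T : measurableType d) (R : realType) (P : probability T R).
Implicit Types (X : R -> {RV P >-> R}) (C : R -> R).
Local Open Scope ereal_scope.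

Definition zero_mean X := forall t : R, 'E_P[X t] = 0.

Definition mean_square_continuous X := forall t : R,
  'E_P[fun w => ((X s w - X t w) ^+ 2)%R] @[s --> t] --> 0.

Definition wide_sense_stationary X :=
  [/\ forall t : R, 'E_P[fun w => (X t w ^+ 2)%R] < +oo,
      forall s t : R, 'E_P[X s] = 'E_P[X t]
    & forall s t h : R, 'E_P[fun w => (X (s + h)%R w * X (t + h)%R w)%R]
                        = 'E_P[fun w => (X s w * X t w)%R]].

(* Only for zero mean processes is this the covariance in the usual sense. *)
Definition covariance_function X C := forall s t : R,
  'E_P[fun w => (X s w * X (s + t)%R w)%R] = (C t)%:E.

(* P(v1, v2, v3); independence of t is part of the requirement. *)
Definition fourth_moment_function X (M4 : R -> R -> R -> R) :=
  forall t v1 v2 v3 : R,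
  'E_P[fun w => (X t w * X (t + v1)%R w * X (t + v2)%R w * X (t + v3)%R w)%R]
  = (M4 v1 v2 v3)%:E.

End Process.

Section Functions.
Context (R : realType).
Local Notation mu := (@lebesgue_measure R).

(* Q = P - P_G *)
Definition cumulant4 (C : R -> R) (M4 : R -> R -> R -> R) (v1 v2 v3 : R) : R :=
  M4 v1 v2 v3 -
  (C v1 * C (v3 - v2) + C v2 * C (v3 - v1) + C v3 * C (v1 - v2)).

(* h_0; extended-real valued, so that an unbounded C gives +oo rather than
   the default value of the real supremum. *)
Definition tail_sup (C : R -> R) (t : R) : \bar R :=
  ereal_sup [set `|C s|%:E | s in [set s : R | `|t| <= s]].

(* "A unique maximum at 0" is unimodality: M decreases away from its strict
   maximum at 0.  A strict global maximum alone does not bound the sums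
   b_n * \sum_v K(b_n v)^2. *)
Definition kernel_majorant (M : R -> R) :=
  [/\ forall x, 0 <= M x,
      forall x, M (- x) = M x,
      mu.-integrable setT (EFin \o M),
      forall x, x != 0 -> M x < M 0
    & forall x y, 0 <= x -> x <= y -> M y <= M x].

Definition covariance_averaging_kernel (K : R -> R) :=
  [/\ continuous K,
      forall x, K (- x) = K x,
      mu.-integrable setT (fun x => (K x ^+ 2)%:E),
      exists2 M, kernel_majorant M & forall x, `|K x| <= M x
    & K 0 = 1].

Definition cumulant_majorant (g : R -> R) :=
  [/\ continuous g,
      forall x, g (- x) = g x,
      forall x, 0 <= g x,
      mu.-integrable setT (EFin \o g)
    & forall x y, 0 <= x -> x <= y -> g y <= g x].

Definition expi (x : R) : R[i] := cos x +i* sin x.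

Definition cRintegral (f : R -> R[i]) : R[i] :=
  (\int[mu]_x complex.Re (f x)) +i* (\int[mu]_x complex.Im (f x)).

Definition cspectral_density (C : R -> R) (lam : R) : R[i] :=
  ((2 * pi)^-1)%:C * cRintegral (fun t => (C t)%:C * expi (- (t * lam))).

(* Nothing is lost by taking the real part: see [spectral_densityE]. *)
Definition spectral_density (C : R -> R) (lam : R) : R :=
  complex.Re (cspectral_density C lam).

End Functions.

Section Estimator.
Context (T : Type) (R : realType).
(* X is the process, K the kernel, r the sampling rate, b the window width. *)
Implicit Types (X : R -> T -> R) (K : R -> R) (r b lam : R) (n : nat).

Definition sample_cov X r n (v : int) (w : T) : R :=
  n%:R^-1 * \sum_(1 <= j < (n - `|v|).+1)
              X (j%:R / r) w * X ((j + `|v|)%N%:R / r) w.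

Definition cspectral_estimator X K r b n lam (w : T) : R[i] :=
  ((2 * pi * r)^-1)%:C *
  (\sum_(v \in [set v : int | (`|v| < n)%N])
     (sample_cov X r n v w * K (b * v%:~R))%:C * expi (- (v%:~R * lam / r))) *
  (\1_(`[- (pi * r), pi * r]) lam)%:C.

(* Nothing is lost by taking the real part: see [spectral_estimatorE]. *)
Definition spectral_estimator X K r b n lam (w : T) : R :=
  complex.Re (cspectral_estimator X K r b n lam w).

End Estimator.

Section Realness.
Context (R : realType).

Let cj (z : R[i]) : R[i] := z^*.

Let real_of_cj z : cj z = z -> (complex.Re z)%:C = z.
Proof.
case: z => x y [] /eqP; rewrite -subr_eq0 -opprD oppr_eq0 -mulr2n.
by rewrite mulrn_eq0/= => /eqP ->.
Qed.

Let cjM x y : cj (x * y) = cj x * cj y.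
Proof. exact: (rmorphM (@conjc R)). Qed.

Let cj_real (x : R) : cj x%:C = x%:C.
Proof. exact: conjc_real. Qed.

Let cj_sum (I : Type) (s : seq I) (F : I -> R[i]) :
  cj (\sum_(i <- s) F i) = \sum_(i <- s) cj (F i).
Proof. exact: (rmorph_sum (@conjc R)). Qed.

Let cj_expi (x : R) : cj (expi x) = expi (- x).
Proof. by rewrite /expi cosN sinN. Qed.

Lemma finite_lags (n : nat) : finite_set [set v : int | (`|v| < n)%N].
Proof.
apply: (@sub_finite_set _ _
  ((Posz @` `I_n) `|` ((fun k => - (Posz k)) @` `I_n))).
  move=> v /= vn; case: (ger0P v) => v0.
    by left; exists `|v|%N => //; rewrite gez0_abs.
  by right; exists `|v|%N => //; rewrite ltz0_abs ?opprK.
by rewrite finite_setU; split; apply: finite_image; exact: finite_II.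
Qed.

Lemma spectral_estimatorE (T : Type) (X : R -> T -> R) (K : R -> R) (r b : R)
    (n : nat) (lam : R) (w : T) : (forall x, K (- x) = K x) ->
  (spectral_estimator X K r b n lam w)%:C = cspectral_estimator X K r b n lam w.
Proof.
move=> Keven; apply: real_of_cj.
rewrite /cspectral_estimator !cjM !cj_real; congr (_ * _ * _).
rewrite [RHS](reindex_fsbig (-%R : int -> int) [set v : int | (`|v| < n)%N]
  [set v : int | (`|v| < n)%N]);
  last first.
  split=> [v /=|u v _ _ /oppr_inj//|v /= vn]; first by rewrite abszN.
  by exists (- v); rewrite ?opprK//= abszN.
rewrite !(fsbig_finite _ _ (finite_lags n)) cj_sum.
apply: eq_bigr => v _; rewrite cjM cj_real cj_expi.
rewrite /sample_cov abszN mulrNz mulrN Keven; congr (_ * expi _).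
by rewrite !mulNr.
Qed.

Lemma spectral_densityE (C : R -> R) (lam : R) :
  measurable_fun setT C -> (forall t, C (- t) = C t) ->
  (spectral_density C lam)%:C = cspectral_density C lam.
Proof.
move=> mC Ceven; apply: real_of_cj.
rewrite /cspectral_density cjM cj_real; congr (_ * _).
rewrite /cRintegral; set f := (X in _ +i* (Rintegral _ _ X)).
suff -> : Rintegral lebesgue_measure setT f = 0 :> R by rewrite /= oppr0.
have fE t : f t = - (C t * sin (t * lam)).
  by rewrite /f /= sinN mul0r addr0 mulrN.
have fN t : f (- t) = - f t by rewrite !fE Ceven mulNr sinN mulrN.
have mf : measurable_fun setT f.
  rewrite (_ : f = fun t => - (C t * sin (t * lam))); last exact/funext.
  apply: measurableT_comp => //; apply: measurable_funM => //.
  apply: (measurableT_comp (f := sin)); last exact: measurable_funM.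
  by apply: continuous_measurable_fun; exact: continuous_sin.
have mEf : measurable_fun setT (EFin \o f) by exact/measurable_EFinP.
rewrite /Rintegral integralE.
suff -> : (\int[lebesgue_measure]_x (fun x => (f x)%:E)^\+ x =
           \int[lebesgue_measure]_x (fun x => (f x)%:E)^\- x)%E.
  by case: (X in (X - X)%E) => [x| |] //=; rewrite subrr.
transitivity (\int[pushforward lebesgue_measure (-%R : _ -> measurableTypeR R)]_x
    ((fun x => (f x)%:E)^\+ x))%E.
  by apply: eq_measure_integral => A mA _; exact/esym/lebesgue_measureN.
rewrite ge0_integral_pushforward//=; last exact: measurable_funepos.
apply: eq_integral => x _ /=.
by rewrite funeposE funenegE fN.
Qed.

End Realness.

(* Main.v *)
Require Import Defs.
From HB Require Import structures.
From mathcomp Require Import all_boot all_order all_algebra.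
From mathcomp Require Import all_classical all_reals all_analysis.
From mathcomp Require Import measurable_realfun ring lra.
Set Implicit Arguments.
Unset Strict Implicit.
Unset Printing Implicit Defensive.
Import Order.TTheory GRing.Theory Num.Theory.
Import numFieldNormedType.Exports.
Local Open Scope classical_set_scope.
Local Open Scope ring_scope.

(** Put [h = 1 / rho n], [theta = lam * h] and [Y i = X (i.+1 * h)].  The estimator
is the quadratic form [sum_(i, j) a (i - j) Y i Y j], up to the factor
[1 / (2 pi rho n)], with [a x = K (b x) cos (x theta)].  Its variance is therefore
a fourfold sum of the covariances
   Cov (Y i Y j, Y k Y l) = c (k - i) c (l - j) + c (l - i) c (k - j) + Q,
where [c x = C (h x)] ([variance_estimator]).

The cumulant part is small: for fixed [i] the sums over [j], [k] and [l] separate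
and are each of order [rho], so that this part contributes [O (rho b)] to the
scaled variance ([cumulant_form_le]).

The two Gaussian parts coincide by symmetry, and two scales separate in them: [c]
lives on lags of order [rho], the kernel on the much longer lags of order [1 / b].
Hence [K (b (k - l))] may be replaced by [K (b (i - j))], because [K] is uniformly
continuous.  The sum over [k] and [l] then factors as [cos ((i - j) theta) D ^+ 2],
where [D] is the sum of [c v cos (v theta)] over all lags, up to the terms that the
ends of the sample cut off, which are negligible on average since [rho] is [o (n)]
([quadratic_form_approx], [gaussian_form_error]).  Now [h D] is a Riemann sum of the
integral of [C x cos (x lam)], which is [2 pi] times the spectral density
([riemann_cos_uniform_cvg]), and what remains is
   b / n * sum_(i, j) K (b (i - j)) ^+ 2 * cos ((i - j) theta) ^+ 2.
Write [cos ^+ 2] as half of [1 + cos (2 _)].  The constant gives half of the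
integral of [K ^+ 2] ([kernel_square_average_cvg]).  For [lam = 0] the cosine gives
the other half.  Otherwise it oscillates with period of order [rho / lam], short
against [1 / b], and averaging over windows of intermediate length shows that its
contribution vanishes ([oscillating_sum_le], [oscillation_uniform_cvg]).  The error
bounds depend on [lam] only through an upper bound of [`|lam|], and in the last step
a lower bound too; this is the asserted uniformity.

Sums over lags are controlled throughout by one device: a function that is
nonincreasing on the half line has its Riemann sums from [T] on bounded by its
integral over the half line from [T] ([sum_le_tail]). *)

Local Notation lag i j := (i%:R - j%:R) (only parsing).

(** * Radial majorants and Riemann sums *)

Section RadialMajorant.
Context {R : realType}.
Notation mu := (@lebesgue_measure R).
Implicit Types (m f : R -> R) (h T x y e : R).

(** The common shape of the bounds on [C], [K] and the fourth cumulant.  Monotonicity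
is what allows sums to be compared with integrals. *)
Definition radial_majorant m :=
  [/\ forall x, 0 <= m x, forall x, m (- x) = m x,
      mu.-integrable setT (EFin \o m)
    & forall x y, 0 <= x -> x <= y -> m y <= m x].

Definition tail_mass m T : R := \int[mu]_(x in `[T, +oo[) m x.

Lemma radial_majorant_norm m x : radial_majorant m -> m `|x| = m x.
Proof. by case=> _ mN _ _; case: (ger0P x) => // _; rewrite mN. Qed.

Lemma radial_majorant_le0 m x : radial_majorant m -> m x <= m 0.
Proof.
move=> Hm; rewrite -(radial_majorant_norm x Hm).
by case: Hm => _ _ _ mle; exact: mle.
Qed.

Lemma integrable_itv f (i : interval R) :
  mu.-integrable setT (EFin \o f) -> mu.-integrable [set` i] (EFin \o f).
Proof. by apply: integrableS. Qed.

Lemma integral_itv_split f (a b : R) (c : itv_bound R) :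
  mu.-integrable setT (EFin \o f) -> a <= b -> (BLeft b <= c)%O ->
  \int[mu]_(x in [set` Interval (BLeft a) c]) f x =
  \int[mu]_(x in `[a, b[) f x + \int[mu]_(x in [set` Interval (BLeft b) c]) f x.
Proof.
move=> fi ab bc.
rewrite (@itv_bndbnd_setU _ _ _ (BLeft b)) ?bnd_simp// Rintegral_setU//=.
- by rewrite -itv_bndbnd_setU ?bnd_simp//; exact: integrable_itv.
- apply/disj_setPS => y [/=]; rewrite !in_itv/= => /andP[_ yb] /andP[].
  by rewrite leNgt yb.
Qed.

Arguments integrable_itv {f} i _.
Arguments integral_itv_split {f a b} c _ _ _.

Lemma integral_cell_cst (a b c : R) : a <= b ->
  mu.-integrable `[a, b[ (EFin \o cst c) /\
  \int[mu]_(x in `[a, b[) c = (b - a) * c.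
Proof.
move=> ab; split.
  apply/integrableP; split; first exact/measurable_EFinP.
  rewrite /= integral_cst//= lebesgue_measure_itv/=.
  by case: ifP => _; rewrite ?mule0// -EFinM ltry.
have muE : fine (mu `[a, b[) = b - a.
  rewrite lebesgue_measure_itv/= lte_fin; case: ltP => [//|ba].
  by rewrite (le_anti (introT andP (conj ab ba))) subrr.
by rewrite Rintegral_cst// mulrC; congr (_ * _).
Qed.

Arguments integral_cell_cst {a b} c.

Lemma integral_cell_error f a b c eta : a <= b ->
  mu.-integrable setT (EFin \o f) ->
  (forall x, a <= x < b -> `|f x - c| <= eta) ->
  `|\int[mu]_(x in `[a, b[) f x - (b - a) * c| <= (b - a) * eta.
Proof.
move=> ab fi fc; have [ci cE] := integral_cell_cst c ab.
have [ei eE] := integral_cell_cst eta ab.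
have fi' := integrable_itv `[a, b[ fi.
rewrite -cE -eE -RintegralB//.
have di : mu.-integrable `[a, b[ (EFin \o (fun x => f x - c)).
  exact: (integrableB _ fi' ci).
apply: (le_trans (le_normr_Rintegral _ di)) => //.
by apply: le_Rintegral => //; have /integrable_norm := di.
Qed.

Lemma ge_integral_cell m a b : radial_majorant m -> 0 <= a -> a <= b ->
  (b - a) * m b <= \int[mu]_(x in `[a, b[) m x.
Proof.
move=> [m0 _ mi mle] a0 ab; have [bi <-] := integral_cell_cst (m b) ab.
apply: le_Rintegral => //.
- exact: integrable_itv.
- move=> x /=; rewrite in_itv/= => /andP[ax xb].
  by rewrite mle// ?(ltW xb)// (le_trans a0).
Qed.

Lemma radial_majorantZ (m : R -> R) (a : R) : 0 <= a -> radial_majorant m ->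
  radial_majorant (fun x => a * m x).
Proof.
move=> a0 [m0 mN mi mle]; split.
- by move=> x; rewrite mulr_ge0.
- by move=> x; rewrite mN.
- exact: (integrableZl _ _ mi).
- by move=> x y x0 xy; rewrite ler_wpM2l// mle.
Qed.

Lemma tail_mass_ge0 m T : radial_majorant m -> 0 <= tail_mass m T.
Proof. by case=> m0 _ _ _; apply: Rintegral_ge0. Qed.

Lemma tail_mass_le m x y : radial_majorant m -> x <= y ->
  tail_mass m y <= tail_mass m x.
Proof.
move=> [m0 _ mi _] xy; rewrite /tail_mass (integral_itv_split +oo%O mi xy)//.
by rewrite lerDr; apply: Rintegral_ge0.
Qed.

(** Dominated convergence for the restrictions of [m] to the half lines from
[0], [1], [2] and so on. *)
Lemma tail_mass_cvg0 m e : radial_majorant m -> 0 < e ->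
  exists2 T, 0 <= T & forall x, T <= x -> tail_mass m x < e.
Proof.
move=> Hm e0; have [m0 _ mi _] := Hm.
pose f_ (n : nat) (x : R) := ((m \_ `[n%:R, +oo[) x)%:E.
have fn n : (\int[mu]_x f_ n x)%E = (tail_mass m n%:R)%:E.
  rewrite /f_ /tail_mass fineK; last exact/integrable_fin_num/integrable_itv.
  rewrite [RHS]integral_mkcond; apply: eq_integral => x _.
  by rewrite restrict_EFin.
have mm : measurable_fun setT (EFin \o m) by case/integrableP : mi.
have := @dominated_convergence _ _ R mu setT measurableT f_ (cst 0%E) (EFin \o m).
case.
- move=> n; rewrite /f_ /=; apply/measurable_EFinP.
  apply: (iffLR (measurable_restrictT m (measurable_itv `[n%:R, +oo[))).
  by apply: measurable_funTS; exact/measurable_EFinP.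
- exact: measurable_cst.
- apply: aeW => x _; apply: cvg_near_cst.
  exists (Num.truncn `|x|).+1 => // n /= xn.
  rewrite /f_ patchE mem_setE in_itv/= andbT; case: ifPn => // nx.
  have := truncnS_gt `|x|; rewrite ltNge => /negP[].
  by rewrite (le_trans _ (le_trans nx (ler_norm _)))// ler_nat.
- exact: mi.
- apply: aeW => x n _; rewrite /f_ /= lee_fin patchE.
  by case: ifP; rewrite ?normr0// ger0_norm.
move=> _ _; rewrite integral0.
rewrite (_ : [sequence _]_n = EFin \o (fun n => tail_mass m n%:R)); last first.
  by apply/funext => n /=; rewrite fn.
move=> /fine_cvg/= /cvgrPdist_lt/(_ e e0) [N _ HN].
exists N%:R => // x Nx; apply: le_lt_trans (tail_mass_le Hm Nx) _.
have := HN N (leqnn N); rewrite /= sub0r normrN ger0_norm//.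
exact: tail_mass_ge0.
Qed.

(** By monotonicity [m (T + 1)] is at most the integral of [m]
between [T] and [T + 1]. *)
Lemma radial_majorant_cvg0 m e : radial_majorant m -> 0 < e ->
  exists2 T, 0 <= T & forall x, T <= `|x| -> m x < e.
Proof.
move=> Hm e0; have [m0 _ mi mle] := Hm.
have [T T0 HT] := tail_mass_cvg0 Hm e0.
exists (T + 1); first by rewrite addr_ge0.
move=> x Tx; rewrite -(radial_majorant_norm x Hm).
apply: le_lt_trans (HT T (lexx T)).
have T1 : T <= T + 1 by rewrite lerDl.
apply: (le_trans (mle _ _ _ Tx)); first by rewrite addr_ge0.
have := ge_integral_cell Hm T0 T1.
rewrite addrAC subrr add0r mul1r => /le_trans; apply.
by rewrite /tail_mass (integral_itv_split +oo%O mi T1)// lerDl Rintegral_ge0.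
Qed.

(** Each term is at most the integral over the cell to its left.  Keeping the
remaining tail on the left-hand side makes the induction on [q] telescope. *)
Lemma sum_le_tail m h p q : radial_majorant m -> 0 < h -> (p <= q)%N ->
  h * (\sum_(p <= v < q) m (h * v.+1%:R)) + tail_mass m (h * q%:R)
  <= tail_mass m (h * p%:R).
Proof.
move=> Hm h0; elim: q => [|q IH].
  by rewrite leqn0 => /eqP ->; rewrite big_geq// mulr0 add0r.
rewrite leq_eqVlt => /predU1P[->|pq].
  by rewrite big_geq// mulr0 add0r.
rewrite ltnS in pq.
rewrite big_nat_recr//= mulrDr -addrA; apply: le_trans (IH pq).
rewrite lerD2l [leRHS](@integral_itv_split _ _ (h * q.+1%:R) +oo%O)//; last 2 first.
  by case: Hm.
  by rewrite ler_pM2l// ler_nat.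
rewrite lerD2r.
have := @ge_integral_cell m (h * q%:R) (h * q.+1%:R) Hm.
rewrite -mulrBr -natrB// subSnn mulr1; apply.
  by rewrite mulr_ge0// ltW.
by rewrite ler_pM2l// ler_nat.
Qed.

Lemma dominated_continuous_integrable m f : radial_majorant m -> continuous f ->
  (forall x, `|f x| <= m x) -> mu.-integrable setT (EFin \o f).
Proof.
move=> [m0 _ mi _] cf fm;
have mf : measurable_fun setT f by exact: continuous_measurable_fun.
apply: (le_integrable _ _ _ mi) => //; first exact/measurable_EFinP.
by move=> x _ /=; rewrite lee_fin (ger0_norm (m0 x)).
Qed.

(** The first [p] cells are compared one by one through the modulus [eta]; beyond
[h * p] the sum, however long, and the integral are each at most the tail mass. *)
Lemma riemann_sum_error m f h eta p N :
  radial_majorant m -> continuous f -> (forall x, `|f x| <= m x) -> 0 < h ->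
  (forall x y, `|x - y| <= h -> `|f x - f y| <= eta) -> (p <= N)%N ->
  `|h * (\sum_(0 <= v < N) f (h * v.+1%:R)) - \int[mu]_(x in `[0, +oo[) f x|
  <= h * p%:R * eta + 2 * tail_mass m (h * p%:R).
Proof.
move=> Hm cf fm h0 fh pN; have fi := dominated_continuous_integrable Hm cf fm.
have hp0 k : 0 <= h * k%:R by rewrite mulr_ge0// ltW.
rewrite (@big_cat_nat _ _ _ p)//=.
rewrite (integral_itv_split +oo%O fi (hp0 p))// mulrDr.
have -> (a b c d : R) : a + b - (c + d) = (a - c) + (b - d) by ring.
apply: (le_trans (ler_normD _ _)); apply: lerD; last first.
  apply: (le_trans (ler_normB _ _)); rewrite mulr_natl mulr2n; apply: lerD.
    rewrite normrM gtr0_norm//.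
    apply: (le_trans (ler_wpM2l (ltW h0) (ler_norm_sum _ _ _))).
    apply: le_trans (sum_le_tail Hm h0 pN).
    rewrite -[leLHS]addr0; apply: lerD; last exact: tail_mass_ge0.
    by rewrite ler_pM2l//; apply: ler_sum => v _; exact: fm.
  have fi' := integrable_itv `[h * p%:R, +oo[ fi.
  apply: (le_trans (le_normr_Rintegral _ fi')) => //.
  apply: le_Rintegral => //; first by have /integrable_norm := fi'.
  by apply: integrable_itv; case: Hm.
elim: p {pN} => [|p IH].
  by rewrite big_geq// !mulr0 mul0r set_itvco0 Rintegral_set0 subrr normr0.
rewrite big_nat_recr//= mulrDr.
have hle : h * p%:R <= h * p.+1%:R by rewrite ler_pM2l// ler_nat.
rewrite (integral_itv_split (BLeft (h * p.+1%:R)) fi (hp0 p))//.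
have -> (a b c d : R) : a + b - (c + d) = (a - c) + (b - d) by ring.
apply: (le_trans (ler_normD _ _)).
have -> : h * p.+1%:R * eta = h * p%:R * eta + h * eta.
  by rewrite -(natr1 p); ring.
apply: lerD => //; rewrite distrC.
have := @integral_cell_error f _ _ (f (h * p.+1%:R)) eta hle fi.
rewrite -mulrBr -natrB// subSnn mulr1; apply => x /andP[hx xh].
apply: fh; rewrite ler0_norm; last by rewrite subr_le0 ltW.
by rewrite opprB lerBlDr (le_trans _ (lerD (lexx h) hx))// -(natr1 p); lra.
Qed.

(** Reduction to the nonnegative case through [f = (f + `|f|) - `|f|]. *)
Lemma even_integral f : continuous f -> mu.-integrable setT (EFin \o f) ->
  (forall x, f (- x) = f x) ->
  \int[mu]_x f x = 2 * \int[mu]_(x in `[0, +oo[) f x.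
Proof.
move=> cf fi fN.
have nfi : mu.-integrable setT (EFin \o (fun x => `|f x|)).
  by have /integrable_norm := fi.
have pfi : mu.-integrable setT (EFin \o (fun x => f x + `|f x|)).
  exact: (integrableD _ fi nfi).
have sym (g : R -> R) : (forall x, 0 <= g x) -> continuous g ->
    (forall x, g (- x) = g x) ->
    mu.-integrable setT (EFin \o g) ->
    \int[mu]_x g x = 2 * \int[mu]_(x in `[0, +oo[) g x.
  move=> g0 cg gN gi; rewrite /Rintegral ge0_symfun_integralT//; last first.
    by move=> x /=; rewrite gN.
  by rewrite -set_itvcy fineM//; exact/integrable_fin_num/integrable_itv.
have dec (D : set R) : measurable D -> \int[mu]_(x in D) f x =
    \int[mu]_(x in D) (f x + `|f x|) - \int[mu]_(x in D) `|f x|.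
  move=> mD; rewrite -RintegralB//; last 2 first.
    exact: integrableS pfi.
    exact: integrableS nfi.
  by apply: eq_Rintegral => x _; rewrite addrK.
rewrite !dec// !sym//.
- by rewrite mulrBr.
- by move=> x; apply: cvg_norm; exact: cf.
- by move=> x; rewrite fN.
- by move=> x; have := ler_norm (- f x); rewrite normrN; lra.
- by move=> x; apply: cvgD; [exact: cf|apply: cvg_norm; exact: cf].
- by move=> x; rewrite fN.
Qed.

(** Heine's theorem on a compact interval outside which [m], hence [f], is below
[e / 2]. *)
Lemma dominated_unif_continuous m f e : radial_majorant m -> continuous f ->
  (forall x, `|f x| <= m x) -> 0 < e ->
  exists2 d, 0 < d & forall x y, `|x - y| <= d -> `|f x - f y| <= e.
Proof.
move=> Hm cf fm e0; have e20 : 0 < e / 2 by rewrite divr_gt0.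
have [T T0 HT] := radial_majorant_cvg0 Hm e20.
have cov := iffLR (compact_near_coveringP _) (@segment_compact R (- (T + 1)) (T + 1)).
have near_d : \forall d \near (0 : R)^'+, `[- (T + 1), T + 1] `<=`
    [set x | forall y, `|x - y| <= d -> `|f x - f y| <= e].
  apply: cov => x _.
  have /cvgrPdist_lt/(_ _ e20) := cf x.
  move=> /nbhs_ballP[r /= r0 Hr].
  exists (ball x (r / 2), [set d | d < r / 2]) => /=.
    split; first by apply: nbhsx_ballx; rewrite divr_gt0.
    by near=> d; near: d; apply: nbhs_right_lt; rewrite divr_gt0.
  move=> [z d] /= [xz dr] y zy.
  have fz : `|f x - f z| < e / 2.
    by apply: Hr; rewrite /ball/=; apply: lt_trans xz _; lra.
  have fy : `|f x - f y| < e / 2.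
    apply: Hr; rewrite /ball/=.
    have -> : x - y = (x - z) + (z - y) by ring.
    by apply: (le_lt_trans (ler_normD _ _)); move: xz; rewrite /ball/=; lra.
  have -> : f z - f y = (f x - f y) - (f x - f z) by ring.
  by apply: (le_trans (ler_normB _ _)); lra.
have [d [d0 d1 Hd]] : exists d : R, [/\ 0 < d, d < 1 & `[- (T + 1), T + 1] `<=`
    [set x | forall y, `|x - y| <= d -> `|f x - f y| <= e]].
  near ((0 : R)^'+) => d; exists d; split; near: d => //.
  - exact: nbhs_right_gt.
  - exact: nbhs_right_lt.
exists d => // x y xy; have [xT|xT] := leP `|x| (T + 1).
  by apply: Hd => //=; rewrite in_itv/= -ler_norml.
have yT : T <= `|y| by have := lerB_dist x y; lra.
have fx := le_lt_trans (fm x) (HT x (le_trans _ (ltW xT))).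
have fy := le_lt_trans (fm y) (HT y yT).
by apply: (le_trans (ler_normB _ _)); have := fx (ltac:(by rewrite lerDl)); lra.
Unshelve. all: by end_near.
Qed.

End RadialMajorant.

(** * Sums over differences of indices *)

Section DifferenceSums.
Context {R : realType}.
Implicit Types (m f c kappa : R -> R) (h x y z theta : R).

Lemma sum_around f (n i : nat) : (i < n)%N ->
  \sum_(k < n) f (k%:R - i%:R) =
  f 0 + \sum_(0 <= v < n - i.+1) f v.+1%:R + \sum_(0 <= v < i) f (- v.+1%:R).
Proof.
move=> lt_in; rewrite -(big_mkord xpredT (fun k : nat => f (k%:R - i%:R))).
rewrite (@big_cat_nat _ _ _ i)//=; last exact: ltnW.
rewrite addrC (big_ltn lt_in) subrr; congr (_ + _ + _).
  rewrite -{1}(add0n i.+1) big_addn; apply: eq_bigr => v _.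
  by rewrite addnS -addSn natrD addrK.
rewrite big_nat_rev/= add0n; apply: eq_big_nat => v /andP[_ vi].
by congr f; rewrite natrB//; ring.
Qed.

Lemma sum_majorant_le m h (n i : nat) : radial_majorant m -> 0 < h ->
  (i < n)%N -> h * \sum_(k < n) m (h * (k%:R - i%:R)) <= h * m 0 + 2 * tail_mass m 0.
Proof.
move=> Hm h0 lt_in; rewrite (sum_around (fun x => m (h * x)) lt_in) mulr0.
have mE q : \sum_(0 <= v < q) m (h * - v.+1%:R) = \sum_(0 <= v < q) m (h * v.+1%:R).
  by apply: eq_bigr => v _; rewrite mulrN; case: Hm => _ ->.
have mS q : h * \sum_(0 <= v < q) m (h * v.+1%:R) <= tail_mass m 0.
  have := sum_le_tail Hm h0 (leq0n q); rewrite mulr0; apply: le_trans.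
  by rewrite lerDl; exact: tail_mass_ge0.
rewrite mE !mulrDr -addrA lerD2l mulr_natl mulr2n.
by apply: lerD; exact: mS.
Qed.

Definition far (p : nat) x : R := (p%:R < `|x|)%R%:R.

Lemma far_ge0 p x : 0 <= far p x.
Proof. exact: ler0n. Qed.

Lemma sum_majorant_far_le m h (p n i : nat) : radial_majorant m -> 0 < h ->
  (i < n)%N ->
  h * \sum_(k < n) far p (k%:R - i%:R) * m (h * (k%:R - i%:R))
  <= 2 * tail_mass m (h * p%:R).
Proof.
move=> Hm h0 lt_in.
rewrite (sum_around (fun x => far p x * m (h * x)) lt_in).
have mE q : \sum_(0 <= v < q) far p (- v.+1%:R) * m (h * - v.+1%:R) =
    \sum_(0 <= v < q) far p (v.+1%:R) * m (h * v.+1%:R).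
  by apply: eq_bigr => v _; rewrite /far normrN mulrN; case: Hm => _ ->.
have mS q : h * \sum_(0 <= v < q) far p (v.+1%:R) * m (h * v.+1%:R)
    <= tail_mass m (h * p%:R).
  have z v : (v < p)%N -> far p (v.+1%:R) = 0 :> R.
    by move=> vp; rewrite /far normr_nat ltr_nat ltnS leqNgt vp.
  have [qp|pq] := leqP q p.
    rewrite big_nat_cond big1 ?mulr0; first exact: tail_mass_ge0.
    by move=> v /andP[/andP[_ vq] _]; rewrite z ?mul0r// (leq_trans vq).
  rewrite (@big_cat_nat _ _ _ p)//=; last exact: ltnW.
  rewrite big_nat_cond big1 ?add0r; last first.
    by move=> v /andP[/andP[_ vp] _]; rewrite z ?mul0r.
  apply: le_trans (sum_le_tail Hm h0 (ltnW pq)).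
  rewrite -[leLHS]addr0; apply: lerD; last exact: tail_mass_ge0.
  rewrite ler_pM2l//; apply: ler_sum => v _.
  have [m0 _ _ _] := Hm.
  by rewrite /far; case: (_ < _); rewrite ?mul1r// mul0r.
rewrite mE {1}/far normr0 ltrn0 mul0r add0r mulrDr mulr_natl mulr2n.
by apply: lerD; exact: mS.
Qed.

Lemma sum_ord_le n (F : 'I_n -> R) (a : R) :
  (forall i, F i <= a) -> \sum_(i < n) F i <= n%:R * a.
Proof.
move=> Fa; apply: (@le_trans _ _ (\sum_(i < n) a)); first exact: ler_sum.
by rewrite sumr_const card_ord mulr_natl.
Qed.

Lemma sum_ord_rev (f : nat -> R) n :
  \sum_(i < n) f (n - i.+1)%N = \sum_(i < n) f i.
Proof. by rewrite [RHS](reindex_inj rev_ord_inj). Qed.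

Section QuadraticForm.
Variables (n : nat) (kappa c : R -> R) (theta : R).

Definition cos_sum (i : nat) : R := \sum_(k < n) c (lag k i) * cos ((lag k i) * theta).
Definition sin_sum (i : nat) : R := \sum_(k < n) c (lag k i) * sin ((lag k i) * theta).

(** Writing [k - l = (k - i) - (l - j) + (i - j)], the addition formulas separate
the sums over [k] and [l]. *)
Lemma double_cos_sum (i j : nat) :
  \sum_(k < n) \sum_(l < n) cos ((lag k l) * theta) * (c (lag k i) * c (lag l j)) =
  cos ((lag i j) * theta) * (cos_sum i * cos_sum j + sin_sum i * sin_sum j) -
  sin ((lag i j) * theta) * (sin_sum i * cos_sum j - cos_sum i * sin_sum j).
Proof.
rewrite /cos_sum /sin_sum !big_distrlr/= !pair_big/= -big_split/= -sumrB.
rewrite !mulr_sumr -sumrB; apply: eq_bigr => -[k l] _ /=.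
have -> : (lag k l) * theta =
    (lag k i) * theta - (lag l j) * theta + (lag i j) * theta by ring.
by rewrite cosD cosB sinB; ring.
Qed.

(** One of the two equal Gaussian parts of the variance of
[sum_(i, j) kappa (i - j) cos ((i - j) theta) Y i Y j], when [c] is the
autocovariance of [Y]. *)
Definition quadratic_form : R :=
  \sum_(i < n) \sum_(j < n) kappa (lag i j) * cos ((lag i j) * theta) *
   \sum_(k < n) \sum_(l < n)
     kappa (lag k l) * cos ((lag k l) * theta) * (c (lag k i) * c (lag l j)).

(** Two errors add up: [W] bounds the cost of freezing [kappa (k - l)] at
[kappa (i - j)], and [E i] the lags from [i] that leave the sample, that is the
defect of [cos_sum i] from its ideal value [D] and of [sin_sum i] from [0]. *)
Lemma quadratic_form_approx (D S L B W : R) (E : nat -> R) :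
  (forall x, c (- x) = c x) -> (forall x, kappa (- x) = kappa x) ->
  (forall x, `|kappa x| <= B) -> `|D| <= S ->
  (forall i, (i < n)%N -> \sum_(k < n) `|c (lag k i)| <= S) ->
  (forall i, (i < n)%N -> \sum_(k < n) `|kappa (lag k i)| <= L) ->
  (forall i, (i < n)%N -> `|cos_sum i - D| <= E i) ->
  (forall i, (i < n)%N -> `|sin_sum i| <= E i) ->
  (forall i j, (i < n)%N -> (j < n)%N -> \sum_(k < n) \sum_(l < n)
     `|kappa (lag k l) - kappa (lag i j)| * (`|c (lag k i)| * `|c (lag l j)|) <= W) ->
  `|quadratic_form - D ^+ 2 *
     \sum_(i < n) \sum_(j < n) kappa (lag i j) ^+ 2 * cos ((lag i j) * theta) ^+ 2|
  <= n%:R * L * W + 6 * B * L * S * \sum_(i < n) E i.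
Proof.
move=> cN kN kB DS cS kL AE BE kW.
pose inner (i j : nat) : R :=
  \sum_(k < n) \sum_(l < n) cos ((lag k l) * theta) * (c (lag k i) * c (lag l j)).
pose G1 : R := \sum_(i < n) \sum_(j < n)
  kappa (lag i j) ^+ 2 * cos ((lag i j) * theta) * inner i j.
have kL' (j : nat) : (j < n)%N -> \sum_(i < n) `|kappa (lag j i)| <= L.
  move=> jn; apply: le_trans (kL j jn).
  by apply: ler_sum => i _; rewrite -opprB kN.
have B0 : 0 <= B := le_trans (normr_ge0 _) (kB 0).
have S0 : 0 <= S := le_trans (normr_ge0 _) DS.
have E0 (i : nat) : (i < n)%N -> 0 <= E i by move=> /BE; exact: le_trans.
have step1 : `|quadratic_form - G1| <= n%:R * L * W.
  rewrite /quadratic_form /G1 -sumrB.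
  apply: (le_trans (ler_norm_sum _ _ _)).
  rewrite -mulrA; apply: sum_ord_le => i; rewrite -sumrB.
  apply: (le_trans (ler_norm_sum _ _ _)).
  apply: le_trans (ler_wpM2r _ (kL' i (ltn_ord i))); last first.
    by apply: le_trans (kW i i (ltn_ord i) (ltn_ord i)); do 2 apply: sumr_ge0 => ? _.
  rewrite mulr_suml; apply: ler_sum => j _.
  have -> : kappa (lag i j) * cos ((lag i j) * theta) *
      (\sum_(k < n) \sum_(l < n)
        kappa (lag k l) * cos ((lag k l) * theta) * (c (lag k i) * c (lag l j))) -
      kappa (lag i j) ^+ 2 * cos ((lag i j) * theta) * inner i j =
      kappa (lag i j) * cos ((lag i j) * theta) * \sum_(k < n) \sum_(l < n)
      (kappa (lag k l) - kappa (lag i j)) * (cos ((lag k l) * theta) *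
         (c (lag k i) * c (lag l j))).
    rewrite (_ : forall x y s t : R, x * y * s - x ^+ 2 * y * t =
      x * y * (s - x * t)); last by move=> x y s t; ring.
    congr (_ * _).
    rewrite /inner mulr_sumr -sumrB; apply: eq_bigr => k _.
    rewrite mulr_sumr -sumrB; apply: eq_bigr => l _.
    by ring.
  rewrite !normrM -[_ * `|cos _| * _]mulrA ler_wpM2l//.
  apply: le_trans (kW i j (ltn_ord i) (ltn_ord j)).
  rewrite -[leRHS]mul1r; apply: ler_pM => //; first exact: cos_max.
  apply: (le_trans (ler_norm_sum _ _ _)); apply: ler_sum => k _.
  apply: (le_trans (ler_norm_sum _ _ _)); apply: ler_sum => l _.
  rewrite !normrM ler_wpM2l// -[leRHS]mul1r ler_wpM2r ?mulr_ge0//.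
  exact: cos_max.
have cosS (i : nat) : (i < n)%N -> `|cos_sum i| <= S.
  move=> lt_in; apply: le_trans (cS i lt_in).
  apply: (le_trans (ler_norm_sum _ _ _)); apply: ler_sum => k _.
  by rewrite normrM -[leRHS]mulr1 ler_wpM2l// cos_max.
have sinS (i : nat) : (i < n)%N -> `|sin_sum i| <= S.
  move=> lt_in; apply: le_trans (cS i lt_in).
  apply: (le_trans (ler_norm_sum _ _ _)); apply: ler_sum => k _.
  by rewrite normrM -[leRHS]mulr1 ler_wpM2l// sin_max.
have innerE (i j : nat) : (i < n)%N -> (j < n)%N ->
    `|inner i j - cos ((lag i j) * theta) * D ^+ 2| <= 3 * S * (E i + E j).
  move=> lt_in lt_jn; rewrite /inner double_cos_sum.
  set z := (lag i j) * theta.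
  have -> : cos z * (cos_sum i * cos_sum j + sin_sum i * sin_sum j) -
      sin z * (sin_sum i * cos_sum j - cos_sum i * sin_sum j) - cos z * D ^+ 2 =
      cos z * ((cos_sum i - D) * cos_sum j + D * (cos_sum j - D) +
               sin_sum i * sin_sum j) -
      sin z * (sin_sum i * cos_sum j - cos_sum i * sin_sum j) by ring.
  have bnd (a b a' b' : R) : `|a| <= a' -> `|b| <= b' -> `|a * b| <= a' * b'.
    by move=> ? ?; rewrite normrM ler_pM.
  have h1 : `|(cos_sum i - D) * cos_sum j| <= E i * S by apply: bnd; auto.
  have h2 : `|D * (cos_sum j - D)| <= S * E j by apply: bnd; auto.
  have h3 : `|sin_sum i * sin_sum j| <= E i * S by apply: bnd; auto.
  have h4 : `|sin_sum i * cos_sum j| <= E i * S by apply: bnd; auto.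
  have h5 : `|cos_sum i * sin_sum j| <= S * E j by apply: bnd; auto.
  have le1 (t a : R) : `|t| <= 1 -> `|t * a| <= `|a|.
    by move=> t1; rewrite normrM -[leRHS]mul1r ler_wpM2r.
  apply: (le_trans (ler_normB _ _)).
  apply: (le_trans (lerD (le1 _ _ (cos_max z)) (le1 _ _ (sin_max z)))).
  apply: (le_trans (lerD (ler_normD _ _) (ler_normB _ _))).
  have h12 := ler_normD ((cos_sum i - D) * cos_sum j) (D * (cos_sum j - D)).
  have := mulr_ge0 S0 (E0 j lt_jn); lra.
have step2 : `|G1 - D ^+ 2 *
     \sum_(i < n) \sum_(j < n) kappa (lag i j) ^+ 2 * cos ((lag i j) * theta) ^+ 2|
    <= 6 * B * L * S * \sum_(i < n) E i.
  have k2 x : kappa x ^+ 2 <= B * `|kappa x|.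
    by rewrite -real_normK ?num_real// expr2 ler_wpM2r.
  have k2L (i : 'I_n) : \sum_(j < n) kappa (lag i j) ^+ 2 <= B * L.
    apply: le_trans (ler_wpM2l B0 (kL' i (ltn_ord i))).
    by rewrite mulr_sumr; apply: ler_sum => j _.
  have -> : 6 * B * L * S * \sum_(i < n) E i =
      \sum_(i < n) B * L * (3 * S * E i) + \sum_(i < n) B * L * (3 * S * E i).
    rewrite -!mulr_sumr; ring.
  apply: (@le_trans _ _ (\sum_(i < n) \sum_(j < n)
     (kappa (lag i j) ^+ 2 * (3 * S * E i) + kappa (lag i j) ^+ 2 * (3 * S * E j)))).
    rewrite /G1 mulr_sumr -sumrB.
    apply: (le_trans (ler_norm_sum _ _ _)); apply: ler_sum => i _.
    rewrite mulr_sumr -sumrB.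
    apply: (le_trans (ler_norm_sum _ _ _)); apply: ler_sum => j _.
    rewrite -mulrDr -mulrDr.
    have -> : kappa (lag i j) ^+ 2 * cos ((lag i j) * theta) * inner i j -
        D ^+ 2 * (kappa (lag i j) ^+ 2 * cos ((lag i j) * theta) ^+ 2) =
        kappa (lag i j) ^+ 2 * (cos ((lag i j) * theta) *
         (inner i j - cos ((lag i j) * theta) * D ^+ 2)) by ring.
    rewrite normrM ger0_norm ?sqr_ge0// ler_wpM2l ?sqr_ge0//.
    rewrite normrM -[leRHS]mul1r ler_pM//; first exact: cos_max.
    exact: innerE.
  under eq_bigr do rewrite big_split/=.
  rewrite big_split/= [X in _ + X <= _]exchange_big/=.
  apply: lerD; apply: ler_sum => i _; rewrite -mulr_suml.
    by rewrite ler_wpM2r// !mulr_ge0// E0.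
  apply: ler_wpM2r; first by rewrite !mulr_ge0// E0.
  apply: le_trans (k2L i); apply: ler_sum => j _.
  by rewrite -[in leRHS]opprB kN.
rewrite -[quadratic_form](subrK G1) -addrA.
exact: le_trans (ler_normD _ _) (lerD step1 step2).
Qed.

End QuadraticForm.

Lemma norm_sum_range_le m h (g : nat -> R) (p q : nat) : radial_majorant m ->
  0 < h -> (p <= q)%N -> (forall v, `|g v| <= m (h * v.+1%:R)) ->
  h * `|\sum_(p <= v < q) g v| <= tail_mass m (h * p%:R).
Proof.
move=> Hm h0 pq gm; apply: le_trans (sum_le_tail Hm h0 pq).
rewrite -[leLHS]addr0; apply: lerD; last exact: tail_mass_ge0.
by rewrite ler_pM2l//; apply: le_trans (ler_norm_sum _ _ _) _; exact: ler_sum.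
Qed.

(** The cosine sum over all lags from [- n] to [n], folded by evenness of [c]. *)
Definition full_cos_sum (n : nat) c theta : R :=
  c 0 + 2 * \sum_(0 <= v < n) c v.+1%:R * cos (v.+1%:R * theta).

Lemma full_cos_sum_le m c h theta n : radial_majorant m -> 0 < h ->
  (forall x, `|c x| <= m (h * x)) ->
  h * `|full_cos_sum n c theta| <= h * m 0 + 2 * tail_mass m 0.
Proof.
move=> Hm h0 cm; rewrite /full_cos_sum.
apply: (le_trans (ler_wpM2l (ltW h0) (ler_normD _ _))).
rewrite mulrDr; apply: lerD.
  by rewrite ler_pM2l//; apply: le_trans (cm 0) _; rewrite mulr0.
rewrite normrM ger0_norm// mulrCA ler_wpM2l//.
rewrite -[X in tail_mass m X](mulr0 h).
apply: (norm_sum_range_le Hm h0 (leq0n n)) => v.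
apply: le_trans (cm _); rewrite normrM -[leRHS]mulr1 ler_wpM2l//.
exact: cos_max.
Qed.

(** The lags missing from [cos_sum] at [i] are those that reach beyond one of the two
ends of the sample. *)
Lemma cos_sum_error m c h theta (n i : nat) : radial_majorant m -> 0 < h ->
  (forall x, c (- x) = c x) -> (forall x, `|c x| <= m (h * x)) -> (i < n)%N ->
  h * `|cos_sum n c theta i - full_cos_sum n c theta| <=
  tail_mass m (h * (n - i.+1)%:R) + tail_mass m (h * i%:R).
Proof.
move=> Hm h0 cN cm lt_in.
pose g v : R := c v.+1%:R * cos (v.+1%:R * theta).
have gm v : `|g v| <= m (h * v.+1%:R).
  apply: le_trans (cm _); rewrite normrM -[leRHS]mulr1 ler_wpM2l//.
  exact: cos_max.
have -> : cos_sum n c theta i - full_cos_sum n c theta =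
    - (\sum_(n - i.+1 <= v < n) g v + \sum_(i <= v < n) g v).
  rewrite /cos_sum (sum_around (fun x => c x * cos (x * theta)) lt_in).
  rewrite mul0r cos0 mulr1 /full_cos_sum -/(g _).
  under [X in _ + X - _]eq_bigr do rewrite cN mulNr cosN.
  have spl q : (q <= n)%N ->
      \sum_(0 <= v < n) g v = \sum_(0 <= v < q) g v + \sum_(q <= v < n) g v.
    by move=> qn; rewrite (@big_cat_nat _ _ _ q).
  have e1 := spl _ (leq_subr i.+1 n); have e2 := spl _ (ltnW lt_in).
  rewrite /g in e1 e2 *.
  by rewrite mulr_natl mulr2n {1}e1 e2; ring.
rewrite normrN; apply: (le_trans (ler_wpM2l (ltW h0) (ler_normD _ _))).
rewrite mulrDr; apply: lerD; apply: norm_sum_range_le => //.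
  exact: leq_subr.
exact: ltnW.
Qed.

(** Opposite lags cancel, except for those whose opposite leaves the sample. *)
Lemma sin_sum_le m c h theta (n i : nat) : radial_majorant m -> 0 < h ->
  (forall x, c (- x) = c x) -> (forall x, `|c x| <= m (h * x)) -> (i < n)%N ->
  h * `|sin_sum n c theta i| <=
  tail_mass m (h * (n - i.+1)%:R) + tail_mass m (h * i%:R).
Proof.
move=> Hm h0 cN cm lt_in.
pose g v : R := c v.+1%:R * sin (v.+1%:R * theta).
have gm v : `|g v| <= m (h * v.+1%:R).
  apply: le_trans (cm _); rewrite normrM -[leRHS]mulr1 ler_wpM2l//.
  exact: sin_max.
have -> : sin_sum n c theta i =
    - \sum_(n - i.+1 <= v < n) g v + \sum_(i <= v < n) g v.
  rewrite /sin_sum (sum_around (fun x => c x * sin (x * theta)) lt_in).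
  rewrite mul0r sin0 mulr0 add0r.
  under [X in _ + X]eq_bigr do rewrite cN mulNr sinN mulrN.
  have spl q : (q <= n)%N ->
      \sum_(0 <= v < n) g v = \sum_(0 <= v < q) g v + \sum_(q <= v < n) g v.
    by move=> qn; rewrite (@big_cat_nat _ _ _ q).
  have := spl _ (leq_subr i.+1 n); rewrite (spl _ (ltnW lt_in)) => e.
  by rewrite sumrN; move: e; rewrite /g; lra.
apply: (le_trans (ler_wpM2l (ltW h0) (ler_normD _ _))); rewrite normrN.
rewrite mulrDr; apply: lerD; apply: norm_sum_range_le => //.
  exact: leq_subr.
exact: ltnW.
Qed.

(** Bounds [h] times a sum of [m] over multiples of [h]: the middle term, and one tail
on each side. *)
Definition sum_bound m h : R := h * m 0 + 2 * tail_mass m 0.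

Lemma sum_bound_ge0 (m : R -> R) x : radial_majorant m -> 0 < x -> 0 <= sum_bound m x.
Proof.
move=> Hm x0; rewrite /sum_bound addr_ge0// mulr_ge0// ?(ltW x0)//.
  by case: Hm.
exact: tail_mass_ge0.
Qed.

Lemma sum_bound_le (m : R -> R) x : radial_majorant m -> x <= 1 ->
  sum_bound m x <= sum_bound m 1.
Proof. by move=> Hm x1; rewrite /sum_bound lerD2r ler_wpM2r//; case: Hm. Qed.

(** [quadratic_form_approx] with its constants computed.  While [`|k - i|] and
[`|l - j|] are at most [p], the lags [k - l] and [i - j] differ by at most [2 p] and the kernel
moves by at most [eps]; the other terms are paid for by the tail of [m] beyond
[h * p]. *)
Lemma gaussian_form_error (M m kappa c : R -> R) (b h theta eps : R) (n p : nat) :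
  radial_majorant M -> radial_majorant m ->
  (forall x, kappa (- x) = kappa x) -> (forall x, `|kappa x| <= M (b * x)) ->
  (forall x, c (- x) = c x) -> (forall x, `|c x| <= m (h * x)) ->
  0 < b -> 0 < h -> (0 < n)%N -> 0 <= eps ->
  (forall x y, `|x - y| <= p%:R + p%:R -> `|kappa x - kappa y| <= eps) ->
  `|b * h ^+ 2 / n%:R * quadratic_form n kappa c theta -
    (h * full_cos_sum n c theta) ^+ 2 * (b / n%:R *
     \sum_(i < n) \sum_(j < n)
       kappa (lag i j) ^+ 2 * cos (lag i j * theta) ^+ 2)|
  <= sum_bound M b * (eps * sum_bound m h ^+ 2 +
        8 * M 0 * sum_bound m h * tail_mass m (h * p%:R)) +
     12 * M 0 * sum_bound M b * sum_bound m h *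
        ((\sum_(i < n) tail_mass m (h * i%:R)) / n%:R).
Proof.
move=> HM Hm kN KM cN Cm b0 h0 n0 eps0 Keps.
pose L := sum_bound M b; pose sigma := sum_bound m h; rewrite -/L -/sigma.
have bn0 : b != 0 by rewrite gt_eqF.
have hn0 : h != 0 by rewrite gt_eqF.
have nn0 : n%:R != 0 :> R by rewrite pnatr_eq0 -lt0n.
have kM0 x : `|kappa x| <= M 0 by apply: le_trans (KM _) (radial_majorant_le0 _ HM).
have M0 : 0 <= M 0 by case: HM.
have tm0 T : 0 <= tail_mass m T by exact: tail_mass_ge0.
pose E i := (tail_mass m (h * (n - i.+1)%:R) + tail_mass m (h * i%:R)) / h.
have sumE : \sum_(i < n) E i = 2 / h * \sum_(i < n) tail_mass m (h * i%:R).
  rewrite /E -mulr_suml big_split/=.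
  rewrite (sum_ord_rev (fun i => tail_mass m (h * i%:R))).
  by field.
have cS (i : nat) : (i < n)%N -> \sum_(k < n) `|c (lag k i)| <= sigma / h.
  move=> lt_in; rewrite ler_pdivlMr// mulrC.
  apply: le_trans (sum_majorant_le Hm h0 lt_in).
  by rewrite ler_pM2l//; apply: ler_sum => k _.
have kL (i : nat) : (i < n)%N -> \sum_(k < n) `|kappa (lag k i)| <= L / b.
  move=> lt_in; rewrite ler_pdivlMr// mulrC.
  apply: le_trans (sum_majorant_le HM b0 lt_in).
  by rewrite ler_pM2l//; apply: ler_sum => k _.
have cU (i : nat) : (i < n)%N ->
    \sum_(k < n) far p (lag k i) * `|c (lag k i)| <= 2 * tail_mass m (h * p%:R) / h.
  move=> lt_in; rewrite ler_pdivlMr// mulrC.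
  apply: le_trans (sum_majorant_far_le p Hm h0 lt_in).
  by rewrite ler_pM2l//; apply: ler_sum => k _; rewrite ler_wpM2l// far_ge0.
have DS : `|full_cos_sum n c theta| <= sigma / h.
  by rewrite ler_pdivlMr// mulrC; exact: full_cos_sum_le.
have AE (i : nat) : (i < n)%N ->
    `|cos_sum n c theta i - full_cos_sum n c theta| <= E i.
  by move=> lt_in; rewrite ler_pdivlMr// mulrC; exact: cos_sum_error.
have BE (i : nat) : (i < n)%N -> `|sin_sum n c theta i| <= E i.
  by move=> lt_in; rewrite ler_pdivlMr// mulrC; exact: sin_sum_le.
pose W := (eps * sigma ^+ 2 + 8 * M 0 * sigma * tail_mass m (h * p%:R)) / h ^+ 2.
have kW (i j : nat) : (i < n)%N -> (j < n)%N -> \sum_(k < n) \sum_(l < n)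
     `|kappa (lag k l) - kappa (lag i j)| * (`|c (lag k i)| * `|c (lag l j)|) <= W.
  move=> lt_in lt_jn.
  pose u (k : 'I_n) := `|c (lag k i)|; pose u' (k : 'I_n) := far p (lag k i) * u k.
  pose w (k : 'I_n) := `|c (lag k j)|; pose w' (k : 'I_n) := far p (lag k j) * w k.
  apply: (@le_trans _ _ (\sum_(k < n) \sum_(l < n)
     (eps * (u k * w l) + 2 * M 0 * (u' k * w l) + 2 * M 0 * (u k * w' l)))).
    apply: ler_sum => k _; apply: ler_sum => l _.
    have -> : eps * (u k * w l) + 2 * M 0 * (u' k * w l) + 2 * M 0 * (u k * w' l) =
       (eps + 2 * M 0 * (far p (lag k i) + far p (lag l j))) * (u k * w l).
      by rewrite /u' /w'; ring.
    apply: ler_wpM2r; first by rewrite mulr_ge0.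
    have far0 x : far p x = 0 \/ far p x = 1 by rewrite /far; case: (_ < _); [right|left].
    have big : `|kappa (lag k l) - kappa (lag i j)| <= 2 * M 0.
      by apply: (le_trans (ler_normB _ _)); rewrite mulr_natl mulr2n lerD.
    have [fk|fk] := far0 (lag k i); last first.
      apply: (le_trans big); rewrite fk mulrDr mulr1.
      have : 0 <= 2 * M 0 * far p (lag l j) by rewrite !mulr_ge0// far_ge0.
      by lra.
    have [fl|fl] := far0 (lag l j); last first.
      by apply: (le_trans big); rewrite fk fl; lra.
    rewrite fk fl addr0 mulr0 addr0; apply: Keps.
    have nfar x : far p x = 0 -> `|x| <= p%:R.
      by rewrite /far; case: ltP => // _ /eqP; rewrite oner_eq0.
    have -> : lag k l - lag i j = lag k i - lag l j :> R by ring.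
    by apply: le_trans (ler_normB _ _) (lerD (nfar _ fk) (nfar _ fl)).
  have -> : \sum_(k < n) \sum_(l < n)
     (eps * (u k * w l) + 2 * M 0 * (u' k * w l) + 2 * M 0 * (u k * w' l)) =
     eps * ((\sum_(k < n) u k) * (\sum_(l < n) w l)) +
     2 * M 0 * ((\sum_(k < n) u' k) * (\sum_(l < n) w l)) +
     2 * M 0 * ((\sum_(k < n) u k) * (\sum_(l < n) w' l)).
    rewrite !big_distrlr/= !pair_big/= !mulr_sumr -!big_split/=.
    exact: eq_bigr.
  have u0 : 0 <= \sum_(k < n) u k by apply: sumr_ge0 => k _; exact: normr_ge0.
  have w0 : 0 <= \sum_(k < n) w k by apply: sumr_ge0 => k _; exact: normr_ge0.
  have u'0 : 0 <= \sum_(k < n) u' k.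
    by apply: sumr_ge0 => k _; apply: mulr_ge0; [exact: far_ge0|exact: normr_ge0].
  have w'0 : 0 <= \sum_(k < n) w' k.
    by apply: sumr_ge0 => k _; apply: mulr_ge0; [exact: far_ge0|exact: normr_ge0].
  have -> : W = eps * (sigma / h * (sigma / h)) +
     2 * M 0 * (2 * tail_mass m (h * p%:R) / h * (sigma / h)) +
     2 * M 0 * (sigma / h * (2 * tail_mass m (h * p%:R) / h)).
    by rewrite /W; field.
  have M20 : 0 <= 2 * M 0 by rewrite mulr_ge0.
  by apply: lerD; first apply: lerD; apply: ler_wpM2l => //;
    apply: ler_pM => //; try exact: cU; exact: cS.
have := quadratic_form_approx cN kN kM0 DS cS kL AE BE kW.
set G := quadratic_form _ _ _ _; set Q := (X in _ ^+ 2 * X) => GQ.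
have -> : b * h ^+ 2 / n%:R * G - (h * full_cos_sum n c theta) ^+ 2 * (b / n%:R * Q) =
   b * h ^+ 2 / n%:R * (G - full_cos_sum n c theta ^+ 2 * Q) by field.
have s0 : 0 < b * h ^+ 2 / n%:R by rewrite divr_gt0 ?mulr_gt0 ?exprn_gt0 ?ltr0n.
rewrite normrM (gtr0_norm s0).
apply: (le_trans (ler_wpM2l (ltW s0) GQ)).
rewrite sumE /W le_eqVlt; apply/orP; left; apply/eqP.
by field; rewrite nn0 hn0.
Qed.

(** Telescoping, as [2 sin theta cos (2 y)] is the difference of
[sin (2 y + theta)] and [sin (2 y - theta)]. *)
Lemma cos_arith_sum z theta (q : nat) :
  2 * sin theta * \sum_(0 <= l < q) cos (2 * (z + l%:R * theta)) =
  sin (2 * z + (2 * q%:R - 1) * theta) - sin (2 * z - theta).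
Proof.
elim: q => [|q IH].
  by rewrite big_geq// !mulr0 sub0r mulN1r subrr.
rewrite big_nat_recr//= mulrDr IH -(natr1 q).
have -> : 2 * z + (2 * (q%:R + 1) - 1) * theta = 2 * (z + q%:R * theta) + theta by ring.
have -> : 2 * z + (2 * q%:R - 1) * theta = 2 * (z + q%:R * theta) - theta by ring.
set w := 2 * (z + _).
by rewrite [sin (w + theta)]sinD [sin (w - theta)]sinB; ring.
Qed.

Lemma cos_arith_sum_le z theta (q : nat) : sin theta != 0 ->
  `|\sum_(0 <= l < q) cos (2 * (z + l%:R * theta))| <= `|sin theta|^-1.
Proof.
move=> s0; rewrite -[leRHS]mul1r ler_pdivlMr ?normr_gt0// mulrC -normrM.
have := cos_arith_sum z theta q.
set S := \sum_(_ <= _ < _) _; set u := sin (_ + _); set v := sin (_ - _) => E.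
have -> : sin theta * S = (u - v) / 2 by rewrite -E; field.
rewrite normrM (@ger0_norm _ 2^-1) ?invr_ge0// ler_pdivrMr// mul1r.
by apply: (le_trans (ler_normB _ _)); have := sin_max (2 * z + (2 * q%:R - 1) * theta);
  have := sin_max (2 * z - theta); rewrite -/u -/v; lra.
Qed.

Lemma sum_shift (f : nat -> R) (n l : nat) :
  \sum_(0 <= i < n) f (i + l)%N = \sum_(l <= i < n + l) f i.
Proof. by rewrite -{2}(add0n l) big_addn addnK. Qed.

(** The sum changes little when its index is shifted by less than [q], and neither
does [kappa]; so it is close to the average over these shifts of sums in which only
the cosine is shifted, and the averaged cosine is at most
[1 / (q * `|sin theta|)]. *)
Lemma oscillating_sum_le (kappa : R -> R) (n q j : nat) (B L omega theta : R) :
  (forall x, `|kappa x| <= B) ->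
  (forall N i, (i < N)%N -> \sum_(k < N) `|kappa (lag k i)| <= L) ->
  (forall x l, (l < q)%N -> `|kappa (x + l%:R) - kappa x| <= omega) ->
  (j < n)%N -> (0 < q)%N -> sin theta != 0 ->
  `|\sum_(i < n) kappa (lag i j) ^+ 2 * cos (2 * (lag i j * theta))| <=
  B * L / (q%:R * `|sin theta|) + 2 * q%:R * B ^+ 2 + 2 * L * omega.
Proof.
move=> kB kL kw jn q0 s0.
pose F (i : nat) := kappa (lag i j) ^+ 2.
pose e (i : nat) := cos (2 * (lag i j * theta)).
pose S := \sum_(0 <= i < n) F i * e i.
have SE : \sum_(i < n) kappa (lag i j) ^+ 2 * cos (2 * (lag i j * theta)) = S.
  by rewrite /S big_mkord.
rewrite SE.
have B0 : 0 <= B := le_trans (normr_ge0 _) (kB 0).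
have L0 : 0 <= L by apply: le_trans (kL n j jn); apply: sumr_ge0 => k _; exact: normr_ge0.
have w0 : 0 <= omega := le_trans (normr_ge0 _) (kw 0 0%N q0).
have e1 i : `|e i| <= 1 by exact: cos_max.
have F0 i : 0 <= F i by exact: sqr_ge0.
have FB i : F i <= B ^+ 2.
  by rewrite /F -real_normK ?num_real// lerXn2r// nnegrE.
have FBk i : F i <= B * `|kappa (lag i j)|.
  by rewrite /F -real_normK ?num_real// expr2 ler_wpM2r.
have a1 i : `|F i * e i| <= B ^+ 2.
  by rewrite normrM -[leRHS]mulr1 ler_pM// ger0_norm.
have range_le u v : `|\sum_(u <= i < v) F i * e i| <= (v - u)%:R * B ^+ 2.
  apply: (le_trans (ler_norm_sum _ _ _)).
  apply: (@le_trans _ _ (\sum_(u <= i < v) B ^+ 2)); first exact: ler_sum.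
  by rewrite sumr_const_nat mulr_natl.
have shift_le l : (l < q)%N ->
    `|S - \sum_(0 <= i < n) F (i + l)%N * e (i + l)%N| <= 2 * q%:R * B ^+ 2.
  move=> lq.
  have -> : \sum_(0 <= i < n) F (i + l)%N * e (i + l)%N = \sum_(l <= i < n + l) F i * e i.
    exact: (sum_shift (fun i => F i * e i)).
  have eq1 : S + \sum_(n <= i < n + l) F i * e i =
      \sum_(0 <= i < l) F i * e i + \sum_(l <= i < n + l) F i * e i.
    by rewrite /S -!big_cat_nat// ?leq_addr ?leq_addl.
  have -> : S - \sum_(l <= i < n + l) F i * e i =
      \sum_(0 <= i < l) F i * e i - \sum_(n <= i < n + l) F i * e i.
    by apply/eqP; rewrite subr_eq addrAC eq_sym subr_eq eq_sym eq1.
  apply: (le_trans (ler_normB _ _)).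
  apply: (le_trans (lerD (range_le _ _) (range_le _ _))).
  have lqB : l%:R * B ^+ 2 <= q%:R * B ^+ 2 by rewrite ler_wpM2r ?sqr_ge0// ler_nat ltnW.
  by rewrite subn0 addKn; lra.
have freeze_le l : (l < q)%N -> `|\sum_(0 <= i < n) F (i + l)%N * e (i + l)%N -
    \sum_(0 <= i < n) F i * e (i + l)%N| <= 2 * L * omega.
  move=> lq; rewrite -sumrB; apply: (le_trans (ler_norm_sum _ _ _)).
  apply: (@le_trans _ _ (\sum_(0 <= i < n)
     (`|kappa (lag (i + l)%N j)| + `|kappa (lag i j)|) * omega)).
    apply: ler_sum => i _; rewrite -mulrBl normrM -[leRHS]mulr1 ler_pM//.
    rewrite /F subr_sqr normrM mulrC ler_pM// ?ler_normD//.
    by have := kw (lag i j) l lq; rewrite addrAC -natrD.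
  rewrite -mulr_suml ler_wpM2r// big_split/= mulr_natl mulr2n; apply: lerD.
    apply: le_trans (kL (n + l)%N j (ltn_addr l jn)).
    rewrite -(big_mkord xpredT (fun k : nat => `|kappa (lag k j)|)).
    rewrite (sum_shift (fun k => `|kappa (lag k j)|)).
    rewrite [leRHS](@big_cat_nat _ _ _ l)//= ?leq_addl// lerDr.
    by apply: sumr_ge0 => k _; exact: normr_ge0.
  by apply: le_trans (kL n j jn); rewrite big_mkord.
(* Summing over the shifts first brings in the averaged cosine. *)
have avg_le : `|\sum_(0 <= l < q) \sum_(0 <= i < n) F i * e (i + l)%N| <=
    B * L / `|sin theta|.
  rewrite exchange_big/=; apply: (le_trans (ler_norm_sum _ _ _)).
  apply: (@le_trans _ _ (\sum_(0 <= i < n) B * `|kappa (lag i j)| / `|sin theta|)).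
    apply: ler_sum => i _; rewrite -mulr_sumr normrM ger0_norm// ler_pM//.
    rewrite (eq_bigr (fun l : nat => cos (2 * (lag i j * theta + l%:R * theta)))).
      exact: cos_arith_sum_le.
    by move=> l _; rewrite /e natrD; congr cos; ring.
  rewrite -mulr_suml -mulr_sumr ler_wpM2r// ?invr_ge0// ler_wpM2l//.
  by apply: le_trans (kL n j jn); rewrite big_mkord.
have q0' : 0 < q%:R :> R by rewrite ltr0n.
have sp : 0 < `|sin theta| by rewrite normr_gt0.
rewrite -(ler_pM2l q0').
have -> : q%:R * (B * L / (q%:R * `|sin theta|) + 2 * q%:R * B ^+ 2 + 2 * L * omega) =
    B * L / `|sin theta| + q%:R * (2 * q%:R * B ^+ 2 + 2 * L * omega).
  by field; rewrite !gt_eqF.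
rewrite -[q%:R * `|S|]ger0_norm ?mulr_ge0// normrM normr_id -normrM.
have -> : q%:R * S = \sum_(0 <= l < q) \sum_(0 <= i < n) F i * e (i + l)%N +
   \sum_(0 <= l < q) (S - \sum_(0 <= i < n) F i * e (i + l)%N).
  by rewrite sumrB addrC subrK sumr_const_nat subn0 mulr_natl.
apply: (le_trans (ler_normD _ _)); apply: lerD => //.
apply: (le_trans (ler_norm_sum _ _ _)).
rewrite big_mkord; apply: sum_ord_le => l.
rewrite -[S](subrK (\sum_(0 <= i < n) F (i + l)%N * e (i + l)%N)) -addrA.
exact: le_trans (ler_normD _ _) (lerD (shift_le _ (ltn_ord l)) (freeze_le _ (ltn_ord l))).
Qed.

End DifferenceSums.

(** * Moments of finite linear combinations *)

Section Moments.
Context {d : measure_display} {T : measurableType d} {R : realType}.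
Variable P : probability T R.
Implicit Types (f g : T -> R).

Lemma expectation_linear (I : finType) (Z : I -> T -> R) (a e : I -> R) :
  (forall p, P.-integrable setT (EFin \o Z p)) ->
  (forall p, ('E_P[Z p])%E = (e p)%:E) ->
  P.-integrable setT (EFin \o (fun w => \sum_p a p * Z p w)) /\
  ('E_P[fun w => (\sum_p a p * Z p w)%R])%E = (\sum_p a p * e p)%:E.
Proof.
move=> Zi Ze.
have sE : EFin \o (fun w => \sum_p a p * Z p w) =
    (fun w => \sum_p (a p)%:E * (Z p w)%:E)%E.
  by apply/funext => w /=; rewrite -sumEFin.
have aZi p : P.-integrable setT (fun w => (a p)%:E * (Z p w)%:E)%E.
  exact: integrableZl (Zi p).
split; first by rewrite sE; exact: integrable_sum.
rewrite unlock (_ : (fun w => _) = EFin \o (fun w => \sum_p a p * Z p w))//.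
rewrite sE integral_sum// -sumEFin; apply: eq_bigr => p _.
by rewrite (integralZl _ (Zi p))//= EFinM -Ze unlock.
Qed.

Lemma variance_linear (I : finType) (Z : I -> T -> R) (a e : I -> R)
    (s : I -> I -> R) :
  (forall p, P.-integrable setT (EFin \o Z p)) ->
  (forall p q, P.-integrable setT (EFin \o (fun w => Z p w * Z q w))) ->
  (forall p, ('E_P[Z p])%E = (e p)%:E) ->
  (forall p q, ('E_P[fun w => (Z p w * Z q w)%R])%E = (s p q)%:E) ->
  ('V_P[fun w => (\sum_p a p * Z p w)%R])%E =
  (\sum_p \sum_q a p * a q * (s p q - e p * e q))%:E.
Proof.
move=> Zi ZZi Ze ZZe.
have [Wi WE] := expectation_linear a Zi Ze.
set W := fun w => _ in Wi WE *.
have [W2i W2E] := @expectation_linear _ (fun pq w => Z pq.1 w * Z pq.2 w)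
  (fun pq => a pq.1 * a pq.2) (fun pq => s pq.1 pq.2)
  (fun pq => ZZi pq.1 pq.2) (fun pq => ZZe pq.1 pq.2).
have W2 : (fun w => \sum_(pq : I * I) a pq.1 * a pq.2 * (Z pq.1 w * Z pq.2 w)) =
    (W * W)%R.
  apply/funext => w; transitivity (W w * W w); last by [].
  rewrite /W big_distrlr/= pair_big/=.
  by apply: eq_bigr => -[p q] _ /=; ring.
rewrite W2 in W2i W2E.
rewrite /variance covarianceE; try exact/Lfun1_integrable.
rewrite W2E WE -EFinM -EFinB; congr _%:E.
rewrite big_distrlr/= !pair_big/= -sumrB; apply: eq_bigr => -[p q] _ /=.
by ring.
Qed.

Lemma expectation_lty_integrable f : measurable_fun setT f -> (forall w, 0 <= f w) ->
  ('E_P[f] < +oo)%E -> P.-integrable setT (EFin \o f).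
Proof.
move=> mf f0 fy; apply/integrableP; split; first exact/measurable_EFinP.
rewrite unlock in fy; rewrite (eq_integral (fun w => (f w)%:E))// => w _ /=.
by rewrite ger0_norm.
Qed.

Lemma norm_mul_le (x y : R) : `|x * y| <= x ^+ 2 + y ^+ 2.
Proof.
have x2 := sqr_ge0 x; have y2 := sqr_ge0 y.
have p := sqr_ge0 (x + y); have q := sqr_ge0 (x - y).
by rewrite ler_norml; apply/andP; split; lra.
Qed.

Lemma integrable_product f g : measurable_fun setT f -> measurable_fun setT g ->
  P.-integrable setT (EFin \o (fun w => f w ^+ 2)) ->
  P.-integrable setT (EFin \o (fun w => g w ^+ 2)) ->
  P.-integrable setT (EFin \o (fun w => f w * g w)).
Proof.
move=> mf mg fi gi.
have fgi : P.-integrable setT (EFin \o (fun w => f w ^+ 2 + g w ^+ 2)).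
  exact: (integrableD _ fi gi).
apply: (le_integrable _ _ _ fgi) => //.
  by apply/measurable_EFinP; exact: measurable_funM.
move=> w _ /=; rewrite lee_fin [leRHS]ger0_norm ?addr_ge0 ?sqr_ge0//.
exact: norm_mul_le.
Qed.

End Moments.

(** * Covariance function of a stationary process *)

Section Process.
Context {d : measure_display} {T : measurableType d} {R : realType}.
Context {P : probability T R} {X : R -> {RV P >-> R}} {C : R -> R}.
Hypothesis X_wss : wide_sense_stationary X.
Hypothesis X_cov : covariance_function X C.

Let mX t : measurable_fun setT (X t). Proof. exact: measurable_funP. Qed.

Lemma product_integrable s t : P.-integrable setT (EFin \o (fun w => (X s w * X t w)%R)).
Proof.
have sq t' : P.-integrable setT (EFin \o (fun w => X t' w ^+ 2)).
  apply: expectation_lty_integrable; first exact: measurable_funX.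
    by move=> w; exact: sqr_ge0.
  by case: X_wss => + _ _; exact.
exact: integrable_product.
Qed.

Lemma product_expectation s t : ('E_P[fun w => (X s w * X t w)%R])%E = (C (t - s))%:E.
Proof. by rewrite -(X_cov s (t - s)) subrKC. Qed.

Lemma covariance_even t : C (- t) = C t.
Proof.
apply: EFin_inj; rewrite -(X_cov t (- t)) -(X_cov 0 t) subrr add0r.
by congr ('E_P[_])%E; apply/funext => w; rewrite mulrC.
Qed.

Lemma linear_square_expectation (I : finType) (a t : I -> R) :
  ('E_P[fun w => ((\sum_p a p * X (t p) w) ^+ 2)%R])%E =
  (\sum_p \sum_q a p * a q * C (t q - t p))%:E.
Proof.
have [_] := @expectation_linear _ _ _ P _
  (fun (pq : I * I) w => X (t pq.1) w * X (t pq.2) w)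
  (fun pq => a pq.1 * a pq.2) (fun pq => C (t pq.2 - t pq.1))
  (fun pq => product_integrable _ _) (fun pq => product_expectation _ _).
rewrite pair_big/= => <-.
congr ('E_P[_])%E; apply/funext => w; rewrite expr2 big_distrlr/= pair_big/=.
by apply: eq_bigr => -[p q] _ /=; ring.
Qed.

Lemma covariance_quadratic_ge0 (I : finType) (a t : I -> R) :
  0 <= \sum_p \sum_q a p * a q * C (t q - t p).
Proof.
rewrite -lee_fin -linear_square_expectation; apply: expectation_ge0 => w.
exact: sqr_ge0.
Qed.

Lemma covariance_le0 t : `|C t| <= C 0.
Proof.
have H (e : R) := covariance_quadratic_ge0
  (fun i : 'I_2 => if i == 0 then 1 else e) (fun i => if i == 0 then 0 else t).
have := H 1; have := H (- 1); rewrite !big_ord_recl !big_ord0/=.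
rewrite !subrr !subr0 sub0r covariance_even => H1 H2.
by rewrite ler_norml; apply/andP; split; lra.
Qed.

(** Expand the second moments of [a X_0 + (X_(t + u) - X_t)] and
[a X_0 - (X_(t + u) - X_t)], which are nonnegative. *)
Lemma covariance_increment a t u : 0 < a ->
  `|C (t + u) - C t| <= a * C 0 / 2 + (C 0 - C u) / a.
Proof.
move=> a0.
have H (e : R) := covariance_quadratic_ge0
  (fun i : 'I_3 => [:: e * a; 1; -1]`_i) (fun i => [:: 0; t + u; t]`_i).
have E : 0 <= a ^+ 2 * C 0 + 2 * (C 0 - C u) + 2 * a * (C (t + u) - C t) /\
    0 <= a ^+ 2 * C 0 + 2 * (C 0 - C u) - 2 * a * (C (t + u) - C t).
  have := H 1; have := H (- 1); rewrite !big_ord_recl !big_ord0/=.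
  have -> : t - (t + u) = - u by ring.
  have -> : t + u - t = u by ring.
  rewrite !subrr !subr0 !sub0r !covariance_even.
  by move=> H1 H2; split; lra.
have -> : a * C 0 / 2 + (C 0 - C u) / a =
    (a ^+ 2 * C 0 + 2 * (C 0 - C u)) / (2 * a) by field; rewrite gt_eqF.
rewrite ler_pdivlMr ?mulr_gt0// -[2 * a]gtr0_norm ?mulr_gt0// -normrM ler_norml.
by case: E => E1 E2; apply/andP; split; lra.
Qed.

Lemma mean_square_increment_expectation t :
  ('E_P[fun w => ((X t w - X 0 w) ^+ 2)%R])%E = (2 * (C 0 - C t))%:E.
Proof.
transitivity ('E_P[fun w => ((\sum_(i < 2) [:: 1; -1]`_i * X [:: t; 0]`_i w) ^+ 2)%R])%E.
  by congr ('E_P[_])%E; apply/funext => w; rewrite !big_ord_recl big_ord0/=;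
    congr (_ ^+ 2); ring.
rewrite linear_square_expectation; congr _%:E.
rewrite !big_ord_recl !big_ord0/= !subrr subr0 sub0r covariance_even.
by ring.
Qed.

(** In [covariance_increment], [a] is chosen first, so that [a * C 0] is small, and
then [u], by mean square continuity at [0]. *)
Lemma covariance_unif_continuous e : mean_square_continuous X -> 0 < e ->
  exists2 r : R, 0 < r & forall x y, `|x - y| <= r -> `|C x - C y| <= e.
Proof.
move=> msc e0.
have C0 : 0 <= C 0 by apply: le_trans (covariance_le0 0); exact: normr_ge0.
pose a := e / (C 0 + 1).
have C1 : 0 < C 0 + 1 by rewrite ltr_wpDl.
have a0 : 0 < a by rewrite divr_gt0.
have := msc 0; under eq_fun do rewrite mean_square_increment_expectation.
move=> /fine_cvgP[_] /cvgrPdist_lt/(_ (a * e)).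
rewrite mulr_gt0// => /(_ isT)/nbhs_ballP[r /= r0 Hr].
exists (r / 2); first by rewrite divr_gt0.
move=> x y xy; have -> : x = y + (x - y) by ring.
apply: (le_trans (covariance_increment _ _ a0)).
have := Hr (x - y); rewrite /ball/= sub0r normrN => /(_ _).
have ry : `|x - y| < r by lra.
move=> /(_ ry); rewrite sub0r normrN => Hr'.
have h2 : 2 * (C 0 - C (x - y)) < a * e := le_lt_trans (ler_norm _) Hr'.
have h3 : (C 0 - C (x - y)) / a <= e / 2.
  by rewrite ler_pdivrMr//; lra.
have h4 : a * C 0 <= e.
  by rewrite /a mulrAC ler_pdivrMr// ler_pM2l// lerDl.
lra.
Qed.

End Process.

(** * The estimator as a quadratic form *)

Section EstimatorVariance.
Context {R : realType}.

Lemma sum_triangle_exchange (F : nat -> nat -> R) (n q : nat) :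
  \sum_(0 <= i < n) \sum_(0 <= k < n - (i + q)) F i k =
  \sum_(0 <= k < n) \sum_(0 <= i < n - (k + q)) F i k.
Proof.
have widen (G : nat -> R) i : \sum_(0 <= k < n - (i + q)) G k =
    \sum_(0 <= k < n | (i + q + k < n)%N) G k.
  rewrite (big_nat_widen _ _ n)/= ?leq_subr//.
  by apply: eq_bigl => k; rewrite ltn_subRL.
under eq_bigr do rewrite widen; under [RHS]eq_bigr do rewrite widen.
rewrite (exchange_big_dep xpredT)//=; apply: eq_bigr => k _; apply: eq_bigl => i.
by congr (_ < _)%N; rewrite addnAC (addnC i) addnAC.
Qed.

Lemma sum_square_diagonals (g : nat -> nat -> R) (n : nat) :
  \sum_(0 <= i < n) \sum_(0 <= j < n) g i j =
  \sum_(0 <= k < n) \sum_(0 <= j < n - k) g j (j + k)%N +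
  \sum_(0 <= k < n) \sum_(0 <= j < n - k.+1) g (j + k.+1)%N j.
Proof.
have upper : \sum_(0 <= k < n) \sum_(0 <= j < n - k) g j (j + k)%N =
    \sum_(0 <= i < n) \sum_(i <= j < n) g i j.
  have := sum_triangle_exchange (fun j k => g j (j + k)%N) n 0.
  under eq_bigr do rewrite addn0; under [RHS]eq_bigr do rewrite addn0.
  move=> <-; apply: eq_big_nat => i /andP[_ lt_in].
  have := sum_shift (g i) (n - i) i; rewrite subnK ?(ltnW lt_in)// => <-.
  by apply: eq_bigr => k _; rewrite addnC.
have lower : \sum_(0 <= k < n) \sum_(0 <= j < n - k.+1) g (j + k.+1)%N j =
    \sum_(0 <= j < n) \sum_(j.+1 <= i < n) g i j.
  have := sum_triangle_exchange (fun j k => g (j + k.+1)%N j) n 1.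
  under eq_bigr do rewrite addn1; under [RHS]eq_bigr do rewrite addn1.
  move=> <-; apply: eq_big_nat => j /andP[_ lt_jn].
  have := sum_shift (g^~ j) (n - j.+1) j.+1; rewrite subnK// => <-.
  by apply: eq_bigr => k _; rewrite addnS addnS addnC.
rewrite upper lower.
have -> : \sum_(0 <= j < n) \sum_(j.+1 <= i < n) g i j =
    \sum_(0 <= i < n) \sum_(0 <= j < i) g i j.
  have w1 (G : nat -> R) j : (j < n)%N ->
      \sum_(j.+1 <= i < n) G i = \sum_(0 <= i < n | (j < i)%N) G i.
    move=> jn.
    have z : \sum_(0 <= i < j.+1 | (j < i)%N) G i = 0.
      rewrite big_nat_cond big1// => i /andP[/andP[_]].
      by rewrite ltnS leqNgt => /negbTE ->.
    rewrite [RHS](@big_cat_nat _ _ _ j.+1)//= z add0r.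
    rewrite [RHS]big_nat_cond [LHS]big_nat_cond; apply: eq_bigl => i.
    by rewrite andbT; case: ltnP; rewrite ?andbF ?andbT.
  have w2 (G : nat -> R) i : (i < n)%N ->
      \sum_(0 <= j < i) G j = \sum_(0 <= j < n | (j < i)%N) G j.
    by move=> lt_in; rewrite (big_nat_widen _ _ n)//= ltnW.
  rewrite (@eq_big_nat _ _ _ _ _ _
    (fun j => \sum_(0 <= i < n | (j < i)%N) g i j)); last first.
    by move=> j /andP[_ jn]; exact: w1.
  rewrite [RHS](@eq_big_nat _ _ _ _ _ _
    (fun i => \sum_(0 <= j < n | (j < i)%N) g i j)); last first.
    by move=> i /andP[_ lt_in]; exact: w2.
  by rewrite (exchange_big_dep xpredT).
rewrite addrC -big_split/=; apply: eq_big_nat => i /andP[_ lt_in].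
by rewrite (@big_cat_nat _ _ _ i)//= ltnW.
Qed.

Lemma sum_int_lags (F : int -> R) (n : nat) :
  \sum_(v \in [set v : int | (`|v| < n)%N]) F v =
  \sum_(0 <= k < n) F (Posz k) + \sum_(0 <= k < n.-1) F (Negz k).
Proof.
(* [Negz k] is [- k.+1], which is why it stops one step earlier. *)
pose r := [seq Posz k | k <- index_iota 0 n] ++ [seq Negz k | k <- index_iota 0 n.-1].
have ur : uniq r.
  rewrite cat_uniq !map_inj_uniq ?iota_uniq//=; try by move=> ? ? [].
  rewrite andbT; apply/hasPn => _ /mapP[k _ ->]; apply/mapP => -[] //.
have -> : [set v : int | (`|v| < n)%N] = [set` r].
  apply/seteqP; split=> v /=; rewrite mem_cat.
    case: v => k /= kn; apply/orP; [left|right]; apply/map_f; rewrite mem_index_iota//.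
    by case: n kn {r ur}.
  case/orP => /mapP[k]; rewrite mem_index_iota => /andP[_ kn] -> //=.
  by case: n kn {r ur}.
by rewrite -fsbig_seq// /r big_cat/= !big_map.
Qed.

Lemma ReM_real (x : R) (z : R[i]%C) : complex.Re (x%:C%C * z) = x * complex.Re z.
Proof. by case: z => u v /=; rewrite mul0r subr0. Qed.

Lemma Re_sum (I : Type) (s : seq I) (F : I -> R[i]%C) :
  complex.Re (\sum_(i <- s) F i) = \sum_(i <- s) complex.Re (F i).
Proof. by apply: (big_morph (@complex.Re R)) => //= -[? ?] [? ?]. Qed.

Lemma spectral_estimator_quadratic (T : Type) (X : R -> T -> R) (K : R -> R)
    (r b lam : R) (n : nat) (w : T) : (forall x, K (- x) = K x) ->
  spectral_estimator X K r b n lam w =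
  \1_(`[- (pi * r), pi * r]) lam / (2 * pi * r * n%:R) *
  \sum_(i < n) \sum_(j < n) K (b * lag i j) * cos (lag i j * (lam / r)) *
     (X (i.+1%:R / r) w * X (j.+1%:R / r) w).
Proof.
move=> KN.
pose a x := K (b * x) * cos (x * (lam / r)).
have aN x : a (- x) = a x by rewrite /a mulrN KN mulNr cosN.
pose Y (i : nat) := X (i.+1%:R / r) w.
have gE v : sample_cov X r n v w =
    n%:R^-1 * \sum_(0 <= j < n - `|v|) Y j * Y (j + `|v|)%N.
  by rewrite /sample_cov big_add1/=.
rewrite /spectral_estimator /cspectral_estimator.
rewrite [X in complex.Re X]mulrC !ReM_real.
rewrite (fsbig_finite _ _ (finite_lags n)) Re_sum -(fsbig_finite _ _ (finite_lags n)).
rewrite sum_int_lags.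
have FE v : complex.Re ((sample_cov X r n v w * K (b * v%:~R))%:C%C *
     expi (- (v%:~R * lam / r))) =
    n%:R^-1 * (\sum_(0 <= j < n - `|v|) Y j * Y (j + `|v|)%N * a v%:~R).
  by rewrite ReM_real /= cosN gE /a -mulr_suml !mulrA.
rewrite (eq_bigr _ (fun k _ => FE (Posz k))) (eq_bigr _ (fun k _ => FE (Negz k))).
rewrite -!mulr_sumr -mulrDr.
transitivity (\1_(`[- (pi * r), pi * r]) lam * ((2 * pi * r)^-1 * (n%:R^-1 *
   \sum_(0 <= i < n) \sum_(0 <= j < n) Y i * Y j * a (lag i j)))); last first.
  rewrite !mulrA -[_ / _ / n%:R]mulrA -invfM; congr (_ * _).
  rewrite big_mkord; apply: eq_bigr => i _.
  by rewrite big_mkord; apply: eq_bigr => j _; rewrite mulrC.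
congr (_ * (_ * (_ * _))); rewrite sum_square_diagonals; congr (_ + _).
  apply: eq_bigr => k _; apply: eq_bigr => j _.
  by rewrite -[a (lag _ _)]aN opprB natrD addrAC subrr add0r.
transitivity (\sum_(0 <= k < n) \sum_(0 <= j < n - k.+1)
    Y j * Y (j + k.+1)%N * a (Negz k)%:~R).
  case: n {gE FE} => [|n]; first by rewrite !big_geq.
  by rewrite [RHS]big_nat_recr//= subnn [X in _ = _ + X]big_geq// addr0.
apply: eq_bigr => k _; apply: eq_bigr => j _.
rewrite [Y j * _]mulrC; congr (_ * _); rewrite NegzE mulrNz aN natrD addrAC subrr add0r.
by [].
Qed.

End EstimatorVariance.

(** * Variance of the estimator *)

Section VarianceFormula.
Context {d : measure_display} {T : measurableType d} {R : realType}.
Context {P : probability T R} {X : R -> {RV P >-> R}} {C : R -> R}.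
Context {M4 : R -> R -> R -> R}.
Hypothesis X_wss : wide_sense_stationary X.
Hypothesis X_cov : covariance_function X C.
Hypothesis X_m4 : forall t, ('E_P[fun w => (`|X t w| ^+ 4)%R] < +oo)%E.
Hypothesis X_M4 : fourth_moment_function X M4.

Let mX t : measurable_fun setT (X t). Proof. exact: measurable_funP. Qed.

Lemma fourfold_product_integrable s t u v :
  P.-integrable setT (EFin \o (fun w => X s w * X t w * (X u w * X v w))).
Proof.
have X4 t' : P.-integrable setT (EFin \o (fun w => (X t' w ^+ 2) ^+ 2)).
  rewrite (_ : (fun w => _) = (fun w => `|X t' w| ^+ 4)); last first.
    by apply/funext => w; rewrite -exprM -normrX ger0_norm// (exprM _ 2 2) sqr_ge0.
  apply: expectation_lty_integrable => //.
    by apply: measurable_funX; exact: measurableT_comp.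
have XX2 s' t' : P.-integrable setT (EFin \o (fun w => (X s' w * X t' w) ^+ 2)).
  rewrite (_ : (fun w => _) = (fun w => X s' w ^+ 2 * X t' w ^+ 2)); last first.
    by apply/funext => w; rewrite exprMn.
  by apply: integrable_product => //; exact: measurable_funX.
by apply: integrable_product => //; exact: measurable_funM.
Qed.

Definition cumulant_form (n : nat) (a : R -> R) (q : R -> R -> R -> R) : R :=
  \sum_(i < n) \sum_(j < n) \sum_(k < n) \sum_(l < n)
    a (lag i j) * a (lag k l) * q (lag j i) (lag k i) (lag l i).

(** With [i] fixed, the product bound on [q] separates the sums over [j], [k] and
[l]. *)
Lemma cumulant_form_le (n : nat) (a : R -> R) (q : R -> R -> R -> R)
    (g1 g2 g3 : R -> R) (h B : R) :
  radial_majorant g1 -> radial_majorant g2 -> radial_majorant g3 -> 0 < h ->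
  (forall x, `|a x| <= B) ->
  (forall x y z, `|q x y z| <= g1 (h * x) * g2 (h * y) * g3 (h * z)) ->
  h ^+ 3 * `|cumulant_form n a q| <=
  B ^+ 2 * n%:R * (sum_bound g1 h * sum_bound g2 h * sum_bound g3 h).
Proof.
move=> Hg1 Hg2 Hg3 h0 aB qg.
have B0 : 0 <= B := le_trans (normr_ge0 _) (aB 0).
have S g (i : 'I_n) : radial_majorant g ->
    0 <= \sum_(k < n) g (h * lag k i) /\
    h * \sum_(k < n) g (h * lag k i) <= sum_bound g h.
  move=> Hg; split; first by apply: sumr_ge0 => k _; case: Hg.
  exact: sum_majorant_le.
have bnd : `|cumulant_form n a q| <= \sum_(i < n)
    B ^+ 2 * ((\sum_(j < n) g1 (h * lag j i)) * (\sum_(k < n) g2 (h * lag k i)) *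
              (\sum_(l < n) g3 (h * lag l i))).
  apply: (le_trans (ler_norm_sum _ _ _)); apply: ler_sum => i _.
  rewrite -mulrA mulr_suml mulr_sumr.
  apply: (le_trans (ler_norm_sum _ _ _)); apply: ler_sum => j _.
  rewrite mulr_suml !mulr_sumr.
  apply: (le_trans (ler_norm_sum _ _ _)); apply: ler_sum => k _.
  rewrite !mulr_sumr.
  apply: (le_trans (ler_norm_sum _ _ _)); apply: ler_sum => l _.
  rewrite normrM; apply: ler_pM => //; first by rewrite normrM expr2 ler_pM.
  by rewrite mulrA; exact: qg.
apply: (le_trans (ler_wpM2l (exprn_ge0 3 (ltW h0)) bnd)).
rewrite mulr_sumr [leRHS](_ : _ = n%:R *
  (B ^+ 2 * (sum_bound g1 h * sum_bound g2 h * sum_bound g3 h))); last by ring.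
apply: sum_ord_le => i.
have [s1 t1] := S _ i Hg1; have [s2 t2] := S _ i Hg2; have [s3 t3] := S _ i Hg3.
rewrite mulrCA ler_wpM2l ?sqr_ge0//.
have -> (x y z : R) : h ^+ 3 * (x * y * z) = (h * x) * (h * y) * (h * z) by ring.
have hp x : 0 <= x -> 0 <= h * x by move=> ?; rewrite mulr_ge0// ltW.
apply: ler_pM => //; [by apply: mulr_ge0; apply: hp|exact: hp|].
by apply: ler_pM => //; exact: hp.
Qed.

(** The covariance of two products of pairs is the sum of two products of covariances
and a cumulant.  The products give equal sums, since they are exchanged by swapping
[k] and [l] and the weights are even. *)
Lemma variance_estimator (K : R -> R) (r b lam : R) (n : nat) :
  (forall x, K (- x) = K x) ->
  let kappa x := K (b * x) in
  let theta := lam / r in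
  ('V_P[spectral_estimator X K r b n lam])%E =
  ((\1_(`[- (pi * r), pi * r]) lam / (2 * pi * r * n%:R)) ^+ 2 *
   (2 * quadratic_form n kappa (fun x => C (r^-1 * x)) theta +
    cumulant_form n (fun x => kappa x * cos (x * theta))
      (fun x y z => cumulant4 C M4 (r^-1 * x) (r^-1 * y) (r^-1 * z))))%:E.
Proof.
move=> KN kappa theta; set coef := \1_(_) lam / _.
pose a x := kappa x * cos (x * theta); pose c x := C (r^-1 * x).
pose q x y z := cumulant4 C M4 (r^-1 * x) (r^-1 * y) (r^-1 * z).
rewrite -/a -/c -/q.
have aN x : a (- x) = a x by rewrite /a /kappa mulrN KN mulNr cosN.
have cN x : c (- x) = c x by rewrite /c mulrN (covariance_even X_cov).
pose t (i : nat) : R := i.+1%:R / r.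
have tB i j : t i - t j = r^-1 * lag i j by rewrite /t -(natr1 i) -(natr1 j); ring.
pose Z (p : 'I_n * 'I_n) w := X (t p.1) w * X (t p.2) w.
pose s (p u : 'I_n * 'I_n) := M4 (t p.2 - t p.1) (t u.1 - t p.1) (t u.2 - t p.1).
have -> : spectral_estimator X K r b n lam =
    (fun w => \sum_(p : 'I_n * 'I_n) coef * a (lag p.1 p.2) * Z p w).
  apply/funext => w; rewrite spectral_estimator_quadratic// -/coef pair_big/=.
  rewrite mulr_sumr; apply: eq_bigr => -[i j] _ /=.
  by rewrite /Z /a /kappa/= !mulrA.
rewrite (@variance_linear _ _ _ P _ Z _ (fun p : 'I_n * 'I_n => C (t p.2 - t p.1)) s).
- congr _%:E; rewrite /quadratic_form /cumulant_form.
  have sE (p u : 'I_n * 'I_n) : s p u - C (t p.2 - t p.1) * C (t u.2 - t u.1) =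
      c (lag u.1 p.1) * c (lag u.2 p.2) + c (lag u.2 p.1) * c (lag u.1 p.2) +
      q (lag p.2 p.1) (lag u.1 p.1) (lag u.2 p.1).
    rewrite /s /q /c /cumulant4 -!tB.
    have -> : t u.2 - t p.1 - (t u.1 - t p.1) = t u.2 - t u.1 by ring.
    have -> : t u.2 - t p.1 - (t p.2 - t p.1) = t u.2 - t p.2 by ring.
    have -> : t p.2 - t p.1 - (t u.1 - t p.1) = - (t u.1 - t p.2) by ring.
    by rewrite (covariance_even X_cov); ring.
  under eq_bigr do under eq_bigr do rewrite sE.
  rewrite -(pair_big xpredT xpredT (fun i j : 'I_n =>
    \sum_(u : 'I_n * 'I_n) coef * a (lag i j) *
    (coef * a (lag u.1 u.2)) * (c (lag u.1 i) * c (lag u.2 j) +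
      c (lag u.2 i) * c (lag u.1 j) + q (lag j i) (lag u.1 i) (lag u.2 i))))/=.
  rewrite mulrDr !mulr_sumr -big_split/=; apply: eq_bigr => i _.
  rewrite !mulr_sumr -big_split/=; apply: eq_bigr => j _.
  rewrite -(pair_big xpredT xpredT (fun k l : 'I_n => coef * a (lag i j) *
    (coef * a (lag k l)) * (c (lag k i) * c (lag l j) +
      c (lag l i) * c (lag k j) + q (lag j i) (lag k i) (lag l i))))/=.
  pose F (k l : 'I_n) := a (lag k l) * (c (lag k i) * c (lag l j)).
  have swap : \sum_(k < n) \sum_(l < n) F k l =
      \sum_(k < n) \sum_(l < n) a (lag k l) * (c (lag l i) * c (lag k j)).
    rewrite exchange_big/=; apply: eq_bigr => k _; apply: eq_bigr => l _.
    by rewrite /F -opprB aN.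
  rewrite -/(a _).
  have -> : coef ^+ 2 * (2 * (a (lag i j) * (\sum_(k < n) \sum_(l < n) F k l))) =
     coef ^+ 2 * a (lag i j) * (\sum_(k < n) \sum_(l < n) F k l) +
     coef ^+ 2 * a (lag i j) * (\sum_(k < n) \sum_(l < n) F k l) by ring.
  rewrite [in X in _ + X + _]swap !mulr_sumr -!big_split/=; apply: eq_bigr => k _.
  rewrite !mulr_sumr -!big_split/=; apply: eq_bigr => l _.
  by rewrite /F; ring.
- by move=> p; exact: (product_integrable X_wss).
- by move=> p u; exact: fourfold_product_integrable.
- by move=> p; exact: (product_expectation X_cov).
- move=> p u; rewrite /s -(X_M4 (t p.1)) !subrKC.
  by congr ('E_P[_])%E; apply/funext => w; rewrite /Z !mulrA.
Qed.

End VarianceFormula.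

(** * Averages of tails and elementary trigonometric bounds *)

Section SamplingLimits.
Context {R : realType}.
Notation mu := (@lebesgue_measure R).
Implicit Types (m f M K : R -> R) (b h : nat -> R) (e : R).

Lemma near_lt_of_cvg0 (u : nat -> R) e : u n @[n --> \oo] --> (0 : R) -> 0 < e ->
  \forall n \near \oo, u n < e.
Proof.
move=> u0 e0; have /cvgrPdist_lt/(_ _ e0) := u0.
by apply: filterS => n; rewrite sub0r normrN; exact: le_lt_trans (ler_norm _).
Qed.

Lemma near_ge_of_cvgy (u : nat -> R) e : u n @[n --> \oo] --> +oo ->
  \forall n \near \oo, e <= u n.
Proof. by move=> /cvgryPge. Qed.

Lemma near_nat_ge e : \forall n \near \oo, e <= n%:R :> R.
Proof. by apply: near_ge_of_cvgy; exact: cvgr_idn. Qed.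

(** Supplies the index up to which multiples of [s] are treated as near, for a
threshold [T] on the real line. *)
Lemma step_count_bounds (T s : R) : 0 <= T -> 0 < s ->
  T <= s * (Num.truncn (T / s)).+1%:R <= T + s.
Proof.
move=> T0 s0; have Ts : 0 <= T / s by rewrite divr_ge0// ltW.
have /andP[lo hi] := truncn_itv Ts.
rewrite -ler_pdivrMl// mulrC (ltW hi)/= -(natr1 (Num.truncn _)) mulrDr mulr1 lerD2r.
by rewrite mulrC -ler_pdivlMr.
Qed.

(** Only the indices below [T / h], a vanishing fraction of the sample, contribute more
than [e / 2]. *)
Lemma tail_average_small m h e : (forall n, 0 < h n) ->
  (n%:R * h n) @[n --> \oo] --> +oo -> radial_majorant m -> 0 < e ->
  \forall n \near \oo, (\sum_(i < n) tail_mass m (h n * i%:R)) / n%:R <= e.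
Proof.
move=> h0 nh Hm e0; have e20 : 0 < e / 2 by rewrite divr_gt0.
have [T T0 HT] := tail_mass_cvg0 Hm e20.
pose I0 := tail_mass m 0; have I00 : 0 <= I0 by exact: tail_mass_ge0.
near=> n.
have n0 : 0 < n%:R :> R.
  by apply: lt_le_trans ltr01 _; near: n; exact: near_nat_ge.
(* These make [(T / h n + 1) * I0], a bound of the near part, at most [n * e / 2]. *)
have n1 : I0 * 4 / e <= n%:R by near: n; exact: near_nat_ge.
have n2 : T * I0 * 4 / e <= n%:R * h n by near: n; exact: near_ge_of_cvgy.
rewrite ler_pdivrMr//.
have /andP[Tp pT] := step_count_bounds T0 (h0 n); set p := (Num.truncn _).+1 in Tp pT.
have bnd : \sum_(i < n) tail_mass m (h n * i%:R) <=
    n%:R * (e / 2) + \sum_(i < n) (if (i < p)%N then I0 else 0).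
  apply: (@le_trans _ _ (\sum_(i < n) (e / 2 + (if (i < p)%N then I0 else 0)))).
    apply: ler_sum => i _; case: ltnP => [ip|pi].
      apply: ler_wpDl; first exact: ltW.
      by apply: tail_mass_le => //; rewrite mulr_ge0// ltW.
    rewrite addr0; apply/ltW/HT; apply: (le_trans Tp).
    by rewrite ler_pM2l// ler_nat.
  by rewrite big_split/= sumr_const card_ord mulr_natl.
have cnt : \sum_(i < n) (if (i < p)%N then I0 else 0) <= p%:R * I0.
  rewrite -big_mkcond/=.
  apply: (@le_trans _ _ (\sum_(0 <= i < p) I0)); last first.
    by rewrite sumr_const_nat subn0 mulr_natl.
  rewrite -(big_mkord (fun i => (i < p)%N) (fun=> I0)).
  have [np|pn] := leqP n p.
    rewrite [leRHS](@big_cat_nat _ _ _ n)//= -[leLHS]addr0; apply: lerD.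
      by rewrite big_mkcond/=; apply: ler_sum => i _; case: ifP.
    by apply: sumr_ge0.
  by rewrite [leRHS](big_nat_widen _ _ n)//= ltnW.
apply: (le_trans bnd); apply: (le_trans (lerD (lexx _) cnt)).
have pI : p%:R * I0 <= n%:R * (e / 2).
  rewrite -(ler_pM2l (h0 n)).
  rewrite [leLHS]mulrA; apply: (le_trans (ler_wpM2r I00 pT)).
  move: n1 n2; rewrite !ler_pdivrMr// => n1 n2.
  have := ler_wpM2l (ltW (h0 n)) n1; lra.
lra.
Unshelve. all: by end_near.
Qed.

Lemma cos_lipschitz (x y : R) : `|cos x - cos y| <= `|x - y|.
Proof.
wlog xy : x y / x <= y.
  move=> H; have [/H//|/ltW/H] := leP x y.
  by rewrite distrC (distrC y).
have dcos z : z \in `]x, y[%R -> is_derive z 1 cos (- sin z).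
  by move=> _; exact: is_derive_cos.
have [c _ E] := MVT_segment xy dcos (continuous_subspaceT (@continuous_cos R)).
rewrite distrC E normrM normrN (distrC x) -[leRHS]mul1r ler_wpM2r//.
exact: sin_max.
Qed.

(** Mean value theorem, with [cos] decreasing between [0] and [1]. *)
Lemma sin_ge_linear (x : R) : `|x| <= 1 -> cos 1 * `|x| <= `|sin x|.
Proof.
wlog x0 : x / 0 <= x.
  move=> H; have [/H//|/ltW x0] := leP 0 x.
  by have := H (- x); rewrite sinN !normrN oppr_ge0; exact.
rewrite ger0_norm// => x1.
have dsin z : z \in `]0, x[%R -> is_derive z 1 sin (cos z).
  by move=> _; exact: is_derive_sin.
have [c + E] := MVT_segment x0 dsin (continuous_subspaceT (@continuous_sin R)).
rewrite in_itv/= => /andP[c0 cx]; move: E; rewrite sin0 !subr0 => ->.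
rewrite normrM (ger0_norm x0) ler_wpM2r//; apply: le_trans (ler_norm _).
have pi1 : 1 <= pi :> R by apply: le_trans (pi_ge2 _); rewrite ler1n.
rewrite leNgt ltr_cos ?in_itv/= ?ler01 ?c0 ?pi1//.
  by rewrite -leNgt (le_trans cx).
by rewrite (le_trans cx)// (le_trans x1).
Qed.

End SamplingLimits.

(** * Uniform convergence of cosine sums *)

Section UniformLimits.
Context {R : realType}.
Notation mu := (@lebesgue_measure R).
Implicit Types (m f M K C : R -> R) (A : set R) (e : R).

Definition uniform_cvg A (u : nat -> R -> R) (l : R -> R) :=
  forall e, 0 < e -> \forall n \near \oo, forall x, A x -> `|u n x - l x| <= e.

Lemma uniform_cvgD A u v l k : uniform_cvg A u l -> uniform_cvg A v k ->
  uniform_cvg A (fun n x => u n x + v n x) (fun x => l x + k x).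
Proof.
move=> ul vk e e0; have e20 : 0 < e / 2 by rewrite divr_gt0.
move: (ul _ e20) (vk _ e20); apply: filterS2 => n H1 H2 x Ax.
rewrite opprD addrACA [leRHS]splitr.
by apply: le_trans (ler_normD _ _) (lerD _ _); [exact: H1|exact: H2].
Qed.

Lemma uniform_cvgM A u v l k (a c : R) : 0 < a -> 0 < c ->
  (forall x, A x -> `|l x| <= a) -> (forall x, A x -> `|k x| <= c) ->
  uniform_cvg A u l -> uniform_cvg A v k ->
  uniform_cvg A (fun n x => u n x * v n x) (fun x => l x * k x).
Proof.
move=> a0 c0 la kc ul vk e e0.
have e1 : 0 < e / (2 * (c + 1)) by rewrite divr_gt0// mulr_gt0// addr_gt0.
have e2 : 0 < e / (2 * a) by rewrite divr_gt0// mulr_gt0.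
have H1 := ul _ e1; have H2 := vk _ e2; have H3 := vk _ (@ltr01 R).
move: H1 H2 H3; apply: filterS3 => n H1 H2 H3 x Ax.
have -> : u n x * v n x - l x * k x =
    (u n x - l x) * v n x + l x * (v n x - k x) by ring.
have vn : `|v n x| <= c + 1.
  rewrite -[v n x](subrK (k x)) addrC; apply: le_trans (ler_normD _ _) (lerD _ _).
    exact: kc.
  exact: H3.
apply: (le_trans (ler_normD _ _)); rewrite !normrM.
have h1 : `|u n x - l x| * `|v n x| <= e / (2 * (c + 1)) * (c + 1).
  by apply: ler_pM => //; exact: H1.
have h2 : `|l x| * `|v n x - k x| <= a * (e / (2 * a)).
  by apply: ler_pM => //; [exact: la|exact: H2].
have e1E : e / (2 * (c + 1)) * (c + 1) = e / 2.
  by field; rewrite gt_eqF// addr_gt0.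
have e2E : a * (e / (2 * a)) = e / 2 by field; rewrite gt_eqF.
by move: h1 h2; rewrite e1E e2E; lra.
Qed.

Lemma uniform_cvg_le A u l (w : nat -> R -> R) :
  (\forall n \near \oo, forall x, A x -> `|u n x - l x| <= w n x) ->
  uniform_cvg A w (fun=> 0) -> uniform_cvg A u l.
Proof.
move=> uw w0 e e0; have := w0 _ e0; move: uw; apply: filterS2 => n H1 H2 x Ax.
apply: le_trans (H1 x Ax) _; have := H2 x Ax; rewrite subr0.
exact: le_trans (ler_norm _).
Qed.

Lemma uniform_cvg_eq A u u' l : (\forall n \near \oo, forall x, A x -> u n x = u' n x) ->
  uniform_cvg A u' l -> uniform_cvg A u l.
Proof.
move=> uu u'l e e0; have := u'l _ e0; move: uu; apply: filterS2 => n H1 H2 x Ax.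
by rewrite H1//; exact: H2.
Qed.

Lemma continuous_modulation f lam : continuous f ->
  continuous (fun x => f x * cos (x * lam)).
Proof.
move=> cf.
have clam : continuous (fun y : R => y * lam).
  by move=> x; apply: cvgM; [exact: cvg_id|exact: cvg_cst].
have ccos : continuous (fun y : R => cos (y * lam)).
  by move=> x; apply: continuous_comp; [exact: clam|exact: continuous_cos].
by move=> x; apply: cvgM; [exact: cf|exact: ccos].
Qed.

Lemma norm_modulation_le m f lam : (forall x, `|f x| <= m x) ->
  forall x, `|f x * cos (x * lam)| <= m x.
Proof. by move=> fm x; rewrite normrM -[leRHS]mulr1 ler_pM// cos_max. Qed.

(** Uniform because the modulus of continuity of [f x * cos (x * lam)] on steps of
length [s] exceeds that of [f] by at most [m 0 * Lam * s]. *)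
Lemma riemann_cos_uniform_cvg m f (s : nat -> R) (Lam : R) A :
  radial_majorant m -> continuous f -> (forall x, f (- x) = f x) ->
  (forall x, `|f x| <= m x) ->
  (forall e, 0 < e ->
     exists2 r, 0 < r & forall x y, `|x - y| <= r -> `|f x - f y| <= e) ->
  (forall n, 0 < s n) -> s n @[n --> \oo] --> (0 : R) ->
  (n%:R * s n) @[n --> \oo] --> +oo ->
  (forall x, A x -> `|x| <= Lam) ->
  uniform_cvg A
    (fun n lam => s n * full_cos_sum n (fun x => f (s n * x)) (lam * s n))
    (fun lam => \int[mu]_x (f x * cos (x * lam))).
Proof.
move=> Hm cf fN fm uf s0 scvg ns AL e e0.
have m0 : 0 <= m 0 by case: Hm.
have [L0|L0] := leP 0 Lam; last first.
  by apply: nearW => n x /AL xL; have := normr_ge0 x; lra.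
have e16 : 0 < e / 16 by rewrite divr_gt0.
(* The error is [s * `|f 0|] for the term at [0] and twice [riemann_sum_error] for the
   two half lines: [e / 4] each for the term at [0], the two parts of the modulus and
   the tail. *)
have [T T0 HT] := tail_mass_cvg0 Hm e16.
have T1 : 0 < 8 * (T + 1) by lra.
have eta0 : 0 < e / (8 * (T + 1)) by rewrite divr_gt0.
have [r r0 Hr] := uf _ eta0.
have w1 : 0 < e / (4 * (m 0 + 1)) by rewrite divr_gt0// mulr_gt0// ltr_wpDl.
have w2 : 0 < e / (8 * (T + 1) * (m 0 * Lam + 1)).
  by rewrite divr_gt0// mulr_gt0// ltr_wpDl// mulr_ge0.
near=> n => lam Alam.
have sr : s n < r by near: n; exact: near_lt_of_cvg0.
have s1 : s n < 1 by near: n; exact: near_lt_of_cvg0.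
have sw1 : s n < e / (4 * (m 0 + 1)) by near: n; exact: near_lt_of_cvg0.
have sw2 : s n < e / (8 * (T + 1) * (m 0 * Lam + 1)) by near: n; exact: near_lt_of_cvg0.
have nT : T + 1 <= n%:R * s n by near: n; exact: near_ge_of_cvgy.
have /andP[Tp pT] := step_count_bounds T0 (s0 n); set p := (Num.truncn _).+1 in Tp pT.
have pn : (p <= n)%N.
  rewrite -(ler_nat R) -(ler_pM2l (s0 n)) [leRHS]mulrC; lra.
pose F x := f x * cos (x * lam).
have cF : continuous F by exact: continuous_modulation.
have FN x : F (- x) = F x by rewrite /F fN mulNr cosN.
have Fm x : `|F x| <= m x by exact: norm_modulation_le.
have Fi := dominated_continuous_integrable Hm cF Fm.
have Fs x y : `|x - y| <= s n -> `|F x - F y| <= e / (8 * (T + 1)) + m 0 * Lam * s n.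
  move=> xy; rewrite /F.
  have -> : f x * cos (x * lam) - f y * cos (y * lam) =
    (f x - f y) * cos (x * lam) + f y * (cos (x * lam) - cos (y * lam)) by ring.
  apply: (le_trans (ler_normD _ _)); rewrite !normrM; apply: lerD.
    rewrite -[leRHS]mulr1; apply: ler_pM => //; last exact: cos_max.
    by apply: Hr; apply: le_trans xy (ltW sr).
  rewrite -mulrA; apply: ler_pM => //.
    exact: le_trans (fm _) (radial_majorant_le0 _ Hm).
  apply: (le_trans (cos_lipschitz _ _)); rewrite -mulrBl normrM mulrC.
  by apply: ler_pM => //; exact: AL.
have := riemann_sum_error Hm cF Fm (s0 n) Fs pn.
set S := s n * \sum_(_ <= _ < _) _; set J := \int[mu]_(x in _) _ => err.
have -> : \int[mu]_x (f x * cos (x * lam)) = 2 * J by exact: even_integral cF Fi FN.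
have -> : s n * full_cos_sum n (fun x => f (s n * x)) (lam * s n) = s n * f 0 + 2 * S.
  rewrite /full_cos_sum mulr0 mulrDr mulrCA /S; congr (_ + 2 * (_ * _)).
  by apply: eq_bigr => v _; rewrite /F; congr (_ * cos _); ring.
have -> : s n * f 0 + 2 * S - 2 * J = s n * f 0 + 2 * (S - J) by ring.
apply: (le_trans (ler_normD _ _)); rewrite !normrM (gtr0_norm (s0 n)) (@ger0_norm _ 2)//.
have tp : tail_mass m (s n * p%:R) < e / 16 by exact: HT.
have b1 : s n * `|f 0| <= e / 4.
  apply: (@le_trans _ _ (s n * (m 0 + 1))).
    by rewrite ler_pM2l// (le_trans (fm 0))// lerDl.
  apply: (le_trans (ler_wpM2r _ (ltW sw1))); first lra.
  by rewrite le_eqVlt; apply/orP; left; apply/eqP; field; rewrite gt_eqF// ltr_wpDl.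
have b2 : s n * p%:R * (e / (8 * (T + 1)) + m 0 * Lam * s n) <= e / 4.
  apply: (@le_trans _ _ ((T + 1) * (e / (8 * (T + 1)) + e / (8 * (T + 1))))).
    apply: ler_pM.
    - by apply: mulr_ge0; [exact: ltW|exact: ler0n].
    - by apply: addr_ge0; [exact: ltW|apply: mulr_ge0; [exact: mulr_ge0|exact: ltW]].
    - lra.
    - rewrite lerD2l; apply: (@le_trans _ _ ((m 0 * Lam + 1) * s n)).
        by rewrite ler_pM2r// lerDl.
      have ml : 0 < m 0 * Lam + 1 by rewrite ltr_wpDl// mulr_ge0.
      apply: (le_trans (ler_wpM2l (ltW ml) (ltW sw2))).
      rewrite le_eqVlt; apply/orP; left; apply/eqP; field.
      by rewrite !gt_eqF//; lra.
  rewrite le_eqVlt; apply/orP; left; apply/eqP; field.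
  by rewrite gt_eqF//; lra.
lra.
Unshelve. all: by end_near.
Qed.

End UniformLimits.

(** * Limits of kernel averages *)

Section KernelLimits.
Context {R : realType}.
Notation mu := (@lebesgue_measure R).
Variables (M K : R -> R) (b : nat -> R).
Hypothesis HM : radial_majorant M.
Hypothesis cK : continuous K.
Hypothesis KN : forall x, K (- x) = K x.
Hypothesis KM : forall x, `|K x| <= M x.
Hypothesis b_gt0 : forall n, 0 < b n.
Hypothesis b_cvg0 : b n @[n --> \oo] --> (0 : R).
Hypothesis nb_cvgy : (n%:R * b n) @[n --> \oo] --> +oo.

Let M0 : 0 <= M 0. Proof. by case: HM. Qed.

Let KM0 x : `|K x| <= M 0.
Proof. exact: le_trans (KM x) (radial_majorant_le0 _ HM). Qed.

(** For each [j] the sum over [i] is a Riemann sum of the integral truncated at the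
ends of the sample; the cost is a tail, and tails are small on average. *)
Lemma kernel_square_average_cvg :
  uniform_cvg setT
    (fun n _ => b n / n%:R * \sum_(i < n) \sum_(j < n) K (b n * lag i j) ^+ 2)
    (fun=> \int[mu]_x (K x ^+ 2)).
Proof.
have HM' := radial_majorantZ M0 HM.
pose f x := K x ^+ 2.
have cf : continuous f.
  by move=> x; rewrite /f; under eq_fun do rewrite expr2; apply: cvgM; exact: cK.
have fN x : f (- x) = f x by rewrite /f KN.
have fM x : `|f x| <= M 0 * M x by rewrite /f expr2 normrM ler_pM.
have uf e : 0 < e ->
    exists2 r, 0 < r & forall x y, `|x - y| <= r -> `|f x - f y| <= e.
  exact: dominated_unif_continuous HM' cf fM.
have A0 : forall x : R, [set 0] x -> `|x| <= 0 by move=> x ->; rewrite normr0.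
have lim := riemann_cos_uniform_cvg HM' cf fN fM uf b_gt0 b_cvg0 nb_cvgy A0.
have intE : \int[mu]_x (f x * cos (x * 0)) = \int[mu]_x (K x ^+ 2).
  by apply: eq_Rintegral => x _; rewrite mulr0 cos0 mulr1.
move=> e e0; have e30 : 0 < e / 3 by rewrite divr_gt0.
have avg := tail_average_small b_gt0 nb_cvgy HM' e30.
have n1 := near_nat_ge (1 : R).
move: (lim _ e30) avg n1; apply: filterS3 => n H1 H2 H3 x _.
have n0 : 0 < n%:R :> R by exact: lt_le_trans ltr01 H3.
have := H1 0 erefl; rewrite intE mul0r.
set D := full_cos_sum _ _ _; set I := Rintegral _ _ _ => DI.
suff S : `|b n / n%:R * (\sum_(i < n) \sum_(j < n) K (b n * lag i j) ^+ 2) - b n * D|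
    <= 2 * (e / 3).
  rewrite -[X in X - I](subrK (b n * D)) -addrA.
  by apply: (le_trans (ler_normD _ _)); lra.
have -> : b n / n%:R * (\sum_(i < n) \sum_(j < n) K (b n * lag i j) ^+ 2) - b n * D =
    (\sum_(j < n) b n * (cos_sum n (fun x => f (b n * x)) 0 j - D)) / n%:R.
  have -> : \sum_(i < n) \sum_(j < n) K (b n * lag i j) ^+ 2 =
      \sum_(j < n) cos_sum n (fun x => f (b n * x)) 0 j.
    rewrite exchange_big/=; apply: eq_bigr => j _; apply: eq_bigr => i _.
    by rewrite mulr0 cos0 mulr1.
  rewrite -mulr_sumr sumrB sumr_const card_ord -mulr_natl.
  by field; rewrite gt_eqF.
rewrite normrM normfV (gtr0_norm n0) ler_pdivrMr//.
apply: (le_trans (ler_norm_sum _ _ _)).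
apply: (@le_trans _ _ (\sum_(j < n)
   (tail_mass (fun x => M 0 * M x) (b n * (n - j.+1)%:R) +
    tail_mass (fun x => M 0 * M x) (b n * j%:R)))).
  apply: ler_sum => j _; rewrite normrM (gtr0_norm (b_gt0 n)).
  by apply: cos_sum_error => // y; rewrite ?mulrN ?fN.
rewrite big_split/= (sum_ord_rev (fun j => tail_mass _ (b n * j%:R))).
by move: H2; rewrite ler_pdivrMr//; lra.
Qed.

(** [oscillating_sum_le] with shifts [q] of order [1 / s]: a large multiple of the
period of the cosine, yet far below the scale [1 / b] of the kernel. *)
Lemma oscillation_uniform_cvg (s : nat -> R) (x0 Lam : R) :
  0 < x0 -> (forall n, 0 < s n) -> s n @[n --> \oo] --> (0 : R) ->
  (b n / s n) @[n --> \oo] --> (0 : R) ->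
  uniform_cvg [set lam | x0 <= `|lam| <= Lam]
    (fun n lam => b n / n%:R * \sum_(i < n) \sum_(j < n)
       K (b n * lag i j) ^+ 2 * cos (2 * (lag i j * (lam * s n))))
    (fun=> 0).
Proof.
move=> x00 s0 scvg bs e e0.
pose SB := sum_bound M 1.
have SB0 : 0 <= SB by exact: sum_bound_ge0.
have cos1 : 0 < cos 1 :> R by exact: cos1_gt0.
(* [om], [T] and [w] make the three terms of [oscillating_sum_le], multiplied by [b],
   at most [e / 4] each. *)
pose om := e / (8 * (SB + 1)).
have om0 : 0 < om by rewrite divr_gt0// mulr_gt0// ltr_wpDl.
have [r r0 Hr] := dominated_unif_continuous HM cK KM om0.
pose T := 4 * M 0 * SB / (cos 1 * x0 * e) + 1.
have cx0 : 0 < cos 1 * x0 * e by rewrite !mulr_gt0.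
have T1 : 1 <= T.
  by rewrite lerDr; apply: divr_ge0; [rewrite !mulr_ge0|exact: ltW].
have T0 : 0 <= T by exact: le_trans T1.
have TE : 4 * M 0 * SB <= T * (cos 1 * x0 * e).
  rewrite -ler_pdivrMr// /T lerDl; exact: ler01.
pose w := e / (8 * (M 0 ^+ 2 + 1)).
have w0 : 0 < w by rewrite divr_gt0// mulr_gt0// ltr_wpDl// sqr_ge0.
have rT : 0 < r / (T + 1) by rewrite divr_gt0// ltr_wpDl.
have wT : 0 < w / (T + 1) by rewrite divr_gt0// ltr_wpDl.
have L0 : 0 < (`|Lam| + 1)^-1 by rewrite invr_gt0 ltr_wpDl.
near=> n => lam /andP[xlam lamL].
have lam0 : 0 < `|lam| by exact: lt_le_trans xlam.
have n0 : 0 < n%:R :> R.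
  by apply: lt_le_trans ltr01 _; near: n; exact: near_nat_ge.
have b1 : b n < 1 by near: n; exact: near_lt_of_cvg0.
have s1 : s n < 1 by near: n; exact: near_lt_of_cvg0.
have bsr : b n / s n < r / (T + 1) by near: n; exact: near_lt_of_cvg0.
have bsw : b n / s n < w / (T + 1) by near: n; exact: near_lt_of_cvg0.
have sL : s n < (`|Lam| + 1)^-1 by near: n; exact: near_lt_of_cvg0.
have sn0 := s0 n; have bn0 := b_gt0 n.
have /andP[Tq qT] := step_count_bounds T0 sn0.
set q := (Num.truncn _).+1 in Tq qT.
have bq y : b n / s n < y / (T + 1) -> b n * q%:R <= y.
  rewrite ltr_pdivlMr ?ltr_wpDl// => H.
  have -> : b n * q%:R = b n / s n * (s n * q%:R) by field; rewrite gt_eqF.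
  apply: le_trans (ltW H); rewrite ler_pM2l ?divr_gt0//; lra.
pose theta := lam * s n.
have th1 : `|theta| <= 1.
  rewrite normrM (gtr0_norm sn0).
  apply: (@le_trans _ _ ((`|Lam| + 1) * (`|Lam| + 1)^-1)); last first.
    by rewrite divff// gt_eqF// ltr_wpDl.
  apply: ler_pM => //; [exact: ltW| |exact: ltW].
  by apply: (le_trans lamL); apply: (le_trans (ler_norm _)); rewrite lerDl.
have sin_lo : cos 1 * (x0 * s n) <= `|sin theta|.
  apply: le_trans (sin_ge_linear th1); rewrite ler_pM2l// normrM (gtr0_norm sn0).
  by rewrite ler_pM2r.
have sin0 : 0 < `|sin theta| by apply: lt_le_trans sin_lo; rewrite !mulr_gt0.
have SBn : sum_bound M (b n) <= SB by apply: sum_bound_le => //; exact: ltW.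
have SBn0 : 0 <= sum_bound M (b n) by exact: sum_bound_ge0.
have each (j : 'I_n) : b n * `|\sum_(i < n)
    K (b n * lag i j) ^+ 2 * cos (2 * (lag i j * theta))| <= e.
  have kL (N i : nat) : (i < N)%N ->
      \sum_(k < N) `|K (b n * lag k i)| <= sum_bound M (b n) / b n.
    move=> lt_iN; rewrite ler_pdivlMr// mulrC.
    apply: le_trans (sum_majorant_le HM bn0 lt_iN).
    by rewrite ler_pM2l//; apply: ler_sum => k _.
  have kw x (l : nat) : (l < q)%N ->
      `|K (b n * (x + l%:R)) - K (b n * x)| <= om.
    move=> lq; apply: Hr; rewrite mulrDr addrAC subrr add0r ger0_norm; last first.
      by rewrite mulr_ge0// ltW.
    apply: le_trans (bq _ bsr); rewrite ler_pM2l// ler_nat; exact: ltnW.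
  have := @oscillating_sum_le _ (fun x => K (b n * x)) n q j (M 0)
    (sum_bound M (b n) / b n) om theta (fun x => KM0 _) kL kw (ltn_ord j) isT.
  rewrite -normr_gt0 => /(_ sin0).
  set S := `|_| => HS.
  have := ler_wpM2l (ltW bn0) HS.
  have -> : b n * (M 0 * (sum_bound M (b n) / b n) / (q%:R * `|sin theta|) +
      2 * q%:R * M 0 ^+ 2 + 2 * (sum_bound M (b n) / b n) * om) =
      M 0 * sum_bound M (b n) / (q%:R * `|sin theta|) +
      2 * (b n * q%:R) * M 0 ^+ 2 + 2 * sum_bound M (b n) * om.
    by field; rewrite ?gt_eqF// ltr0n.
  move=> H; apply: (le_trans H).
  have t1 : M 0 * sum_bound M (b n) / (q%:R * `|sin theta|) <= e / 4.
    rewrite ler_pdivrMr ?mulr_gt0// ?ltr0n//.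
    apply: (@le_trans _ _ (M 0 * SB)); first by rewrite ler_wpM2l.
    have : T * (cos 1 * x0) <= q%:R * `|sin theta|.
      apply: (@le_trans _ _ (q%:R * (cos 1 * (x0 * s n)))); last first.
        by rewrite ler_wpM2l.
      have -> : q%:R * (cos 1 * (x0 * s n)) = s n * q%:R * (cos 1 * x0) by ring.
      by rewrite ler_pM2r// mulr_gt0.
    move=> /(ler_wpM2l (ltW e0)) H'; move: TE; lra.
  have t2 : 2 * (b n * q%:R) * M 0 ^+ 2 <= e / 4.
    have M2 : 0 <= M 0 ^+ 2 := sqr_ge0 _.
    have := ler_wpM2r M2 (bq _ bsw).
    have : w * M 0 ^+ 2 <= e / 8.
      have -> : w * M 0 ^+ 2 = M 0 ^+ 2 / (M 0 ^+ 2 + 1) * (e / 8).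
        by rewrite /w; field; rewrite gt_eqF// ltr_wpDl.
      rewrite -[leRHS]mul1r ler_wpM2r//; first by rewrite divr_ge0// ltW.
      by rewrite ler_pdivrMr ?ltr_wpDl// mul1r lerDl.
    lra.
  have t3 : 2 * sum_bound M (b n) * om <= e / 4.
    have h1 := ler_wpM2r (ltW om0) SBn.
    have h2 : SB * om <= e / 8.
      have -> : SB * om = SB / (SB + 1) * (e / 8).
        by rewrite /om; field; rewrite gt_eqF// ltr_wpDl.
      rewrite -[leRHS]mul1r ler_wpM2r//; first by rewrite divr_ge0// ltW.
      by rewrite ler_pdivrMr ?ltr_wpDl// mul1r lerDl.
    lra.
  lra.
rewrite subr0 exchange_big/= mulrAC normrM normfV (gtr0_norm n0) ler_pdivrMr//.
rewrite normrM (gtr0_norm bn0) mulrC.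
apply: (@le_trans _ _ (\sum_(j < n) b n * `|\sum_(i < n)
    K (b n * lag i j) ^+ 2 * cos (2 * (lag i j * theta))|)).
  by rewrite -mulr_sumr mulrC ler_pM2l//; exact: ler_norm_sum.
by rewrite [leRHS]mulrC; apply: sum_ord_le.
Unshelve. all: by end_near.
Qed.

End KernelLimits.

(** * Limit of the Gaussian part *)

Section VarianceLimit.
Context {R : realType}.
Notation mu := (@lebesgue_measure R).

Lemma mul_div_succ_le (c e : R) : 0 <= c -> 0 < e -> c * (e / (c + 1)) <= e.
Proof.
move=> c0 e0; have c1 : 0 < c + 1 by rewrite ltr_wpDl.
by rewrite mulrCA ler_piMr// ?(ltW e0)// ler_pdivrMr// mul1r lerDl.
Qed.

(** The factor [Tinf] carries all that distinguishes the frequency [0]. *)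
Lemma gaussian_uniform_cvg (M m K C : R -> R) (b s : nat -> R) (A : set R)
    (Lam tb : R) (Tinf : R -> R) :
  radial_majorant M -> continuous K -> (forall x, K (- x) = K x) ->
  (forall x, `|K x| <= M x) ->
  radial_majorant m -> continuous C -> (forall x, C (- x) = C x) ->
  (forall x, `|C x| <= m x) ->
  (forall e, 0 < e ->
     exists2 r, 0 < r & forall x y, `|x - y| <= r -> `|C x - C y| <= e) ->
  (forall n, 0 < b n) -> b n @[n --> \oo] --> (0 : R) ->
  (forall n, 0 < s n) -> s n @[n --> \oo] --> (0 : R) ->
  (n%:R * s n) @[n --> \oo] --> +oo ->
  (b n / s n) @[n --> \oo] --> (0 : R) ->
  (forall x, A x -> `|x| <= Lam) -> 0 < tb -> (forall x, A x -> `|Tinf x| <= tb) ->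
  uniform_cvg A (fun n lam => b n / n%:R * \sum_(i < n) \sum_(j < n)
     K (b n * lag i j) ^+ 2 * cos (lag i j * (lam * s n)) ^+ 2) Tinf ->
  uniform_cvg A (fun n lam => b n * s n ^+ 2 / n%:R *
     quadratic_form n (fun x => K (b n * x)) (fun x => C (s n * x)) (lam * s n))
    (fun lam => (\int[mu]_x (C x * cos (x * lam))) ^+ 2 * Tinf lam).
Proof.
move=> HM cK KN KM Hm cC CN Cm uC b0 bcvg s0 scvg ns bs AL tb0 Ttb Tcvg.
pose I lam := \int[mu]_x (C x * cos (x * lam)).
pose D n lam := s n * full_cos_sum n (fun x => C (s n * x)) (lam * s n).
have DI : uniform_cvg A D I := riemann_cos_uniform_cvg Hm cC CN Cm uC s0 scvg ns AL.
have M0 : 0 <= M 0 by case: HM.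
have m0 : 0 <= m 0 by case: Hm.
pose a := \int[mu]_x m x + 1.
have a0 : 0 < a by rewrite ltr_wpDl// Rintegral_ge0// => x _; case: Hm.
have Ia lam : `|I lam| <= a.
  have Fm := norm_modulation_le lam Cm.
  have Fi := dominated_continuous_integrable Hm (continuous_modulation cC) Fm.
  apply: (le_trans (le_normr_Rintegral _ Fi)) => //.
  apply: (@le_trans _ _ (\int[mu]_x m x)); last by rewrite lerDl.
  apply: le_Rintegral => //; first by have /integrable_norm := Fi.
  by case: Hm.
have DDI : uniform_cvg A (fun n lam => D n lam * D n lam) (fun lam => I lam * I lam).
  by apply: (uniform_cvgM a0 a0) => // x _; exact: Ia.
have := uniform_cvgM (mulr_gt0 a0 a0) tb0 _ Ttb DDI Tcvg.
have II x : A x -> `|I x * I x| <= a * a by rewrite normrM ler_pM.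
move=> /(_ II) main.
pose sig := sum_bound m 1; pose SB := sum_bound M 1.
have sig0 : 0 <= sig by exact: sum_bound_ge0.
have SB0 : 0 <= SB by exact: sum_bound_ge0.
suff err : uniform_cvg A (fun n lam => b n * s n ^+ 2 / n%:R *
     quadratic_form n (fun x => K (b n * x)) (fun x => C (s n * x)) (lam * s n) -
     D n lam * D n lam * (b n / n%:R * \sum_(i < n) \sum_(j < n)
     K (b n * lag i j) ^+ 2 * cos (lag i j * (lam * s n)) ^+ 2)) (fun=> 0).
  move=> e e0; have := uniform_cvgD err main e0; apply: filterS => n H x Ax.
  by have := H x Ax; rewrite subrK add0r expr2.
move=> e e0; have e30 : 0 < e / 3 by rewrite divr_gt0.
pose c1 := SB * sig ^+ 2; have c10 : 0 <= c1 by rewrite mulr_ge0// sqr_ge0.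
pose c2 := SB * (8 * M 0 * sig); have c20 : 0 <= c2 by rewrite !mulr_ge0.
pose c3 := 12 * M 0 * SB * sig; have c30 : 0 <= c3 by rewrite !mulr_ge0.
pose om := e / 3 / (c1 + 1); have om0 : 0 < om by rewrite divr_gt0// ltr_wpDl.
pose t2 := e / 3 / (c2 + 1); have t20 : 0 < t2 by rewrite divr_gt0// ltr_wpDl.
pose t3 := e / 3 / (c3 + 1); have t30 : 0 < t3 by rewrite divr_gt0// ltr_wpDl.
have [r r0 Hr] := dominated_unif_continuous HM cK KM om0.
have [T T0 HT] := tail_mass_cvg0 Hm t20.
have avg := tail_average_small s0 ns Hm t30.
have rT : 0 < r / (2 * (T + 1)) by rewrite divr_gt0// mulr_gt0// ltr_wpDl.
near=> n => lam Alam.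
have n0 : 0 < n%:R :> R.
  by apply: lt_le_trans ltr01 _; near: n; exact: near_nat_ge.
have b1 : b n < 1 by near: n; exact: near_lt_of_cvg0.
have s1 : s n < 1 by near: n; exact: near_lt_of_cvg0.
have bsr : b n / s n < r / (2 * (T + 1)) by near: n; exact: near_lt_of_cvg0.
have av : (\sum_(i < n) tail_mass m (s n * i%:R)) / n%:R <= t3 by near: n.
have sn0 := s0 n; have bn0 := b0 n.
have /andP[Tp pT] := step_count_bounds T0 sn0.
set p := (Num.truncn _).+1 in Tp pT.
have bp : b n * (p%:R + p%:R) <= r.
  move: bsr; rewrite ltr_pdivlMr ?mulr_gt0 ?ltr_wpDl// => H.
  have -> : b n * (p%:R + p%:R) = b n / s n * (2 * (s n * p%:R)).
    by field; rewrite gt_eqF.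
  by apply: le_trans (ltW H); rewrite ler_pM2l ?divr_gt0//; lra.
have kN x : K (b n * - x) = K (b n * x) by rewrite mulrN KN.
have cN x : C (s n * - x) = C (s n * x) by rewrite mulrN CN.
have Kom x y : `|x - y| <= p%:R + p%:R -> `|K (b n * x) - K (b n * y)| <= om.
  move=> xy; apply: Hr; rewrite -mulrBr normrM (gtr0_norm bn0).
  by apply: le_trans bp; rewrite ler_pM2l.
have n0' : (0 < n)%N by rewrite -(ltr0n R).
have := gaussian_form_error (lam * s n) HM Hm kN (fun x => KM _) cN
  (fun x => Cm _) bn0 sn0 n0' (ltW om0) Kom.
rewrite subr0 -expr2 => /le_trans; apply.
have SBn : 0 <= sum_bound M (b n) <= SB.
  by rewrite sum_bound_ge0//= sum_bound_le// ltW.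
have sgn : 0 <= sum_bound m (s n) <= sig.
  by rewrite sum_bound_ge0//= sum_bound_le// ltW.
have tl : tail_mass m (s n * p%:R) <= t2 by apply/ltW/HT.
have tl0 : 0 <= tail_mass m (s n * p%:R) by exact: tail_mass_ge0.
have av0 : 0 <= (\sum_(i < n) tail_mass m (s n * i%:R)) / n%:R.
  by rewrite divr_ge0 ?(ltW n0)//; apply: sumr_ge0 => i _; exact: tail_mass_ge0.
move: (sum_bound M (b n)) (sum_bound m (s n)) (tail_mass _ _) (_ / n%:R)
  SBn sgn tl tl0 av av0
  => x y z u /andP[x0 xS] /andP[y0 yS] zt z0 ut u0.
have y2 : 0 <= y ^+ 2 <= sig ^+ 2 by rewrite sqr_ge0 lerXn2r// nnegrE.
have h1 : x * (om * y ^+ 2) <= e / 3.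
  apply: le_trans (mul_div_succ_le c10 e30).
  rewrite -/om /c1 -[leRHS]mulrA [sig ^+ 2 * _]mulrC.
  case/andP: y2 => ? ?.
  by apply: ler_pM => //; [rewrite mulr_ge0// ltW|rewrite ler_pM2l].
have h2 : x * (8 * M 0 * y * z) <= e / 3.
  apply: le_trans (mul_div_succ_le c20 e30); rewrite -/t2 /c2 -[leRHS]mulrA.
  apply: ler_pM => //; first by rewrite !mulr_ge0.
  by apply: ler_pM => //; [rewrite !mulr_ge0|rewrite ler_wpM2l// mulr_ge0].
have h3 : 12 * M 0 * x * y * u <= e / 3.
  apply: le_trans (mul_div_succ_le c30 e30); rewrite -/t3 /c3.
  apply: ler_pM => //; first by rewrite !mulr_ge0.
  by apply: ler_pM => //; [rewrite !mulr_ge0|rewrite ler_wpM2l// mulr_ge0].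
rewrite mulrDr; lra.
Unshelve. all: by end_near.
Qed.

(** The bound [C 0] makes the supremum finite. *)
Lemma tail_sup_majorant (C : R -> R) : (forall t, `|C t| <= C 0) ->
  (forall t, C (- t) = C t) -> mu.-integrable setT (tail_sup C) ->
  radial_majorant (fun t => fine (tail_sup C t)) /\
  forall t, `|C t| <= fine (tail_sup C t).
Proof.
move=> C0 CN hi.
have lo t : (`|C t|%:E <= tail_sup C t)%E.
  apply: ereal_sup_ubound; exists `|t| => //=.
  by case: (ger0P t) => // _; rewrite CN.
have up t : (tail_sup C t <= (C 0)%:E)%E.
  by apply: ge_ereal_sup => _ [u _ <-]; rewrite lee_fin.
have fin t : tail_sup C t \is a fin_num.
  rewrite ge0_fin_numE; last by apply: le_trans (lo t); rewrite lee_fin.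
  by apply: le_lt_trans (up t) _; rewrite ltry.
split; last by move=> t; rewrite -lee_fin fineK.
split.
- by move=> t; rewrite fine_ge0//; apply: le_trans (lo t); rewrite lee_fin.
- by move=> t; rewrite /tail_sup normrN.
- rewrite (_ : EFin \o _ = tail_sup C)//; apply/funext => t /=; exact: fineK.
- move=> x y x0 xy; rewrite -lee_fin !fineK//; apply: ereal_sup_le => _ [u /= yu <-].
  exists u => //=; apply: le_trans yu.
  by rewrite !ger0_norm// (le_trans x0).
Qed.

Lemma kernel_majorant_radial (M : R -> R) : kernel_majorant M -> radial_majorant M.
Proof. by case. Qed.

Lemma cumulant_majorant_radial (g : R -> R) :
  cumulant_majorant g -> radial_majorant g.
Proof. by case. Qed.

Lemma spectral_densityE_cos (C : R -> R) (lam : R) :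
  spectral_density C lam = (2 * pi)^-1 * \int[mu]_x (C x * cos (x * lam)).
Proof.
rewrite /spectral_density /cspectral_density ReM_real /=; congr (_ * _).
by apply: eq_Rintegral => x _; rewrite cosN mul0r subr0.
Qed.

End VarianceLimit.

(** * Limit of the scaled variance *)

Section SpectralEstimator.
Context {d : measure_display} {T : measurableType d} {R : realType}.
Context {P : probability T R} {X : R -> {RV P >-> R}} {C K : R -> R}.
Context {b rho : nat -> R} {M4 : R -> R -> R -> R} {g1 g2 g3 : R -> R}.
Notation mu := (@lebesgue_measure R).
Hypothesis X_msc : mean_square_continuous X.
Hypothesis X_wss : wide_sense_stationary X.
Hypothesis X_cov : covariance_function X C.
Hypothesis b_gt0 : forall n, 0 < b n.
Hypothesis rho_gt0 : forall n, 0 < rho n.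
Hypothesis h0_int : mu.-integrable setT (tail_sup C).
Hypothesis K_kernel : covariance_averaging_kernel K.
Hypothesis b_cvg0 : b n @[n --> \oo] --> (0 : R).
Hypothesis nb_cvgy : (n%:R * b n) @[n --> \oo] --> +oo.
Hypothesis rho_cvgy : rho n @[n --> \oo] --> +oo.
Hypothesis rhob_cvg0 : (rho n * b n) @[n --> \oo] --> (0 : R).
Hypothesis X_m4 : forall t, ('E_P[fun w => (`|X t w| ^+ 4)%R] < +oo)%E.
Hypothesis X_M4 : fourth_moment_function X M4.
Hypothesis g1_maj : cumulant_majorant g1.
Hypothesis g2_maj : cumulant_majorant g2.
Hypothesis g3_maj : cumulant_majorant g3.
Hypothesis Q_bound : forall v1 v2 v3,
  `|cumulant4 C M4 v1 v2 v3| <= g1 v1 * g2 v2 * g3 v3.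

Let s n := (rho n)^-1.
Let estimator n lam : T -> R := spectral_estimator X K (rho n) (b n) n lam.
Let k2 : R := \int[mu]_x (K x ^+ 2).

Let s_gt0 n : 0 < s n. Proof. by rewrite invr_gt0. Qed.

Let s_cvg0 : s n @[n --> \oo] --> (0 : R).
Proof. by apply/gtr0_cvgV0 => //; exact: nearW. Qed.

Let bs_cvg0 : (b n / s n) @[n --> \oo] --> (0 : R).
Proof. by under eq_fun do rewrite /s invrK mulrC. Qed.

Let ns_cvgy : (n%:R * s n) @[n --> \oo] --> +oo.
Proof.
apply/cvgryPge => a; near=> n.
have r1 : rho n * b n < 1 by near: n; exact: near_lt_of_cvg0.
have na : a <= n%:R * b n by near: n; exact: near_ge_of_cvgy.
apply: (le_trans na); rewrite ler_wpM2l// /s -[leRHS]mul1r ler_pdivlMr//.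
by rewrite mulrC ltW.
Unshelve. all: by end_near.
Qed.

(** By [variance_estimator] the scaled variance is a Gaussian and a cumulant part, as
soon as [pi * rho n] exceeds [Lam] and the indicator in the estimator is [1]. *)
Lemma scaled_variance_uniform_cvg (A : set R) (Lam tb : R) (Tinf : R -> R) :
  (forall x, A x -> `|x| <= Lam) -> 0 < tb -> (forall x, A x -> `|Tinf x| <= tb) ->
  uniform_cvg A (fun n lam => b n / n%:R * \sum_(i < n) \sum_(j < n)
     K (b n * lag i j) ^+ 2 * cos (lag i j * (lam * s n)) ^+ 2) Tinf ->
  uniform_cvg A (fun n lam => n%:R * b n * fine ('V_P[estimator n lam])%E)
    (fun lam => 2 * spectral_density C lam ^+ 2 * Tinf lam).
Proof.
move=> AL tb0 Ttb Tcvg.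
have [cK KN _ [M /kernel_majorant_radial HM KM] _] := K_kernel.
have C0 := covariance_le0 X_wss X_cov; have CN := covariance_even X_cov.
have [Hm Cm] := tail_sup_majorant C0 CN h0_int.
have uC e : 0 < e -> exists2 r, 0 < r & forall x y, `|x - y| <= r -> `|C x - C y| <= e.
  exact: (covariance_unif_continuous X_wss X_cov).
have cC : continuous C.
  move=> x; apply/cvgrPdist_le => e e0; have [r r0 Hr] := uC e e0.
  apply/nbhs_ballP; exists r => //= y xy; apply: Hr; exact: ltW.
have G := gaussian_uniform_cvg HM cK KN KM Hm cC CN Cm uC b_gt0 b_cvg0 s_gt0
  s_cvg0 ns_cvgy bs_cvg0 AL tb0 Ttb Tcvg.
pose I lam := \int[mu]_x (C x * cos (x * lam)).
pose gauss n lam := b n * s n ^+ 2 / n%:R *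
  quadratic_form n (fun x => K (b n * x)) (fun x => C (s n * x)) (lam * s n).
pose cumul n lam := b n * s n ^+ 2 / n%:R *
  cumulant_form n (fun x => K (b n * x) * cos (x * (lam * s n)))
    (fun x y z => cumulant4 C M4 (s n * x) (s n * y) (s n * z)).
have pi0 : 0 < pi :> R := pi_gt0 R.
have varE : \forall n \near \oo, forall lam, A lam ->
   n%:R * b n * fine ('V_P[estimator n lam])%E =
   (2 * pi ^+ 2)^-1 * gauss n lam + (4 * pi ^+ 2)^-1 * cumul n lam.
  near=> n => lam Alam.
  have n0 : n%:R != 0 :> R.
    by rewrite gt_eqF//; apply: lt_le_trans ltr01 _; near: n; exact: near_nat_ge.
  have rL : Lam / pi <= rho n by near: n; exact: near_ge_of_cvgy.
  have ind : \1_(`[- (pi * rho n), pi * rho n]) lam = 1 :> R.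
    rewrite indicE mem_set//= in_itv/= -ler_norml (le_trans (AL _ Alam))//.
    by rewrite mulrC -ler_pdivrMr.
  rewrite /estimator (variance_estimator X_wss X_cov X_m4 X_M4)//= ind.
  rewrite /gauss /cumul -/(s n) /s; move: (pi : R) pi0 => p p0.
  by field; rewrite n0 !gt_eqF.
have cumul0 : uniform_cvg A (fun n lam => (4 * pi ^+ 2)^-1 * cumul n lam) (fun=> 0).
  pose c := M 0 ^+ 2 * (sum_bound g1 1 * sum_bound g2 1 * sum_bound g3 1).
  have S0 (g : R -> R) : cumulant_majorant g -> 0 <= sum_bound g 1.
    by move=> /cumulant_majorant_radial Hg; exact: sum_bound_ge0.
  have c0 : 0 <= c.
    apply: mulr_ge0; first exact: sqr_ge0.
    by apply: mulr_ge0; first apply: mulr_ge0; exact: S0.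
  apply: (@uniform_cvg_le _ _ _ _ (fun n _ => b n / s n * c)).
    near=> n => lam Alam.
    have n0 : 0 < n%:R :> R.
      by apply: lt_le_trans ltr01 _; near: n; exact: near_nat_ge.
    have s1 : s n < 1 by near: n; exact: near_lt_of_cvg0.
    have sn0 := s_gt0 n; have bn0 := b_gt0 n.
    have aB x : `|K (b n * x) * cos (x * (lam * s n))| <= M 0.
      rewrite normrM -[leRHS]mulr1 ler_pM// ?cos_max//.
      exact: le_trans (KM _) (radial_majorant_le0 _ HM).
    have := cumulant_form_le n (cumulant_majorant_radial g1_maj)
      (cumulant_majorant_radial g2_maj) (cumulant_majorant_radial g3_maj)
      sn0 aB (fun x y z => Q_bound _ _ _).
    set Q := cumulant_form _ _ _ => HQ.
    have Sle (g : R -> R) : cumulant_majorant g ->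
        0 <= sum_bound g (s n) <= sum_bound g 1.
      move=> /cumulant_majorant_radial Hg; rewrite sum_bound_ge0//=.
      by rewrite sum_bound_le// ltW.
    have HQ' : s n ^+ 3 * `|Q| <= n%:R * c.
      apply: (le_trans HQ); rewrite /c [leLHS]mulrAC [leRHS]mulrC.
      apply: ler_wpM2r; first exact: ltW.
      apply: ler_wpM2l; first exact: sqr_ge0.
      have /andP[? ?] := Sle _ g1_maj; have /andP[? ?] := Sle _ g2_maj.
      have /andP[? ?] := Sle _ g3_maj.
      by apply: ler_pM => //; [exact: mulr_ge0|exact: ler_pM].
    have p1 : 0 <= (4 * pi ^+ 2 : R)^-1 <= 1.
      rewrite invr_ge0 mulr_ge0 ?sqr_ge0//= invf_le1 ?mulr_gt0 ?exprn_gt0//.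
      by have := pi_ge2 R; move: (pi : R) => p p2; nra.
    rewrite subr0 normrM ger0_norm; last by case/andP: p1.
    rewrite -[leRHS]mul1r; case/andP: p1 => p10 p11.
    apply: ler_pM => //.
    rewrite /cumul -/Q normrM ger0_norm; last first.
      by rewrite divr_ge0 ?mulr_ge0 ?sqr_ge0// ltW.
    have -> : b n * s n ^+ 2 / n%:R * `|Q| = b n / s n * (s n ^+ 3 * `|Q| / n%:R).
      by field; rewrite !gt_eqF.
    apply: ler_wpM2l; first by rewrite divr_ge0// ltW.
    by rewrite ler_pdivrMr// [leRHS]mulrC.
  move=> e e0; have e1 : 0 < e / (c + 1) by rewrite divr_gt0// ltr_wpDl.
  near=> n => lam _.
  have bsn : b n / s n < e / (c + 1) by near: n; exact: near_lt_of_cvg0.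
  rewrite subr0 ger0_norm; last by rewrite mulr_ge0// divr_ge0// ltW.
  apply: le_trans (mul_div_succ_le c0 e0).
  by rewrite mulrC ler_wpM2l// ltW.
apply: (uniform_cvg_eq varE) => e e0.
have e'0 : 0 < 2 * pi ^+ 2 * (e / 2) by rewrite !mulr_gt0 ?exprn_gt0.
have e20 : 0 < e / 2 by rewrite divr_gt0.
move: (G _ e'0) (cumul0 _ e20); apply: filterS2 => n H1 H2 lam Alam.
have -> : 2 * spectral_density C lam ^+ 2 * Tinf lam =
    (2 * pi ^+ 2)^-1 * (I lam ^+ 2 * Tinf lam).
  rewrite spectral_densityE_cos -/(I lam); move: (pi : R) pi0 => p p0.
  by field; rewrite gt_eqF.
rewrite addrAC -mulrBr; apply: (le_trans (ler_normD _ _)).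
have H2' := H2 lam Alam; rewrite subr0 in H2'.
rewrite [leRHS]splitr; apply: lerD => //.
have pp : 0 < 2 * pi ^+ 2 :> R by rewrite mulr_gt0// exprn_gt0.
rewrite normrM normfV (gtr0_norm pp) ler_pdivrMl//.
exact: H1.
Unshelve. all: by end_near.
Qed.

Let kernel_square_cvg : uniform_cvg setT
  (fun n _ => b n / n%:R * \sum_(i < n) \sum_(j < n) K (b n * lag i j) ^+ 2)
  (fun=> k2).
Proof.
have [cK KN _ [M /kernel_majorant_radial HM KM] _] := K_kernel.
exact: (kernel_square_average_cvg HM).
Qed.

Let k2_ge0 : 0 <= k2. Proof. by apply: Rintegral_ge0 => x _; exact: sqr_ge0. Qed.

(** Here the squared cosine averages to [1 / 2]. *)
Lemma scaled_variance_cvg_away (x0 Lam : R) : 0 < x0 ->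
  uniform_cvg [set lam | x0 <= `|lam| <= Lam]
    (fun n lam => n%:R * b n * fine ('V_P[estimator n lam])%E)
    (fun lam => spectral_density C lam ^+ 2 * k2).
Proof.
move=> x00; have [cK KN _ [M /kernel_majorant_radial HM KM] _] := K_kernel.
have osc := @oscillation_uniform_cvg _ M K b HM cK KM b_gt0 b_cvg0 s x0 Lam
  x00 s_gt0 s_cvg0 bs_cvg0.
have Tcvg : uniform_cvg [set lam | x0 <= `|lam| <= Lam]
   (fun n lam => b n / n%:R * \sum_(i < n) \sum_(j < n)
     K (b n * lag i j) ^+ 2 * cos (lag i j * (lam * s n)) ^+ 2) (fun=> k2 / 2).
  move=> e e0; move: (kernel_square_cvg e0) (osc _ e0).
  apply: filterS2 => n H1 H2 lam Alam.
  have := H2 lam Alam; have := H1 lam I; rewrite subr0.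
  set S1 := \sum_(_ < _) _; set S2 := \sum_(_ < _) _; set S := \sum_(_ < _) _.
  have -> : S = (S1 + S2) / 2.
    rewrite /S1 /S2 -big_split/= mulr_suml; apply: eq_bigr => i _.
    rewrite -big_split/= mulr_suml; apply: eq_bigr => j _.
    by rewrite [2 * (_ * _)]mulr_natl cos_mulr2n; field.
  move: (b n / n%:R) S1 S2 => c S1 S2 h1 h2.
  have -> : c * ((S1 + S2) / 2) - k2 / 2 = (c * S1 - k2 + c * S2) / 2 by field.
  rewrite normrM (@ger0_norm _ 2^-1)// ler_pdivrMr//.
  by apply: (le_trans (ler_normD _ _)); lra.
have AL (x : R) : [set lam | x0 <= `|lam| <= Lam] x -> `|x| <= Lam by case/andP.
have tb0 : 0 < k2 / 2 + 1 by rewrite ltr_wpDl// divr_ge0.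
have Ttb (x : R) : [set lam | x0 <= `|lam| <= Lam] x -> `|k2 / 2| <= k2 / 2 + 1.
  by move=> _; rewrite ger0_norm ?divr_ge0// lerDl.
move=> e e0; have := scaled_variance_uniform_cvg AL tb0 Ttb Tcvg e0.
apply: filterS => n H lam Alam.
have -> : spectral_density C lam ^+ 2 * k2 =
   2 * spectral_density C lam ^+ 2 * (k2 / 2) by field.
exact: H.
Qed.

(** Here the squared cosine is identically [1]. *)
Lemma scaled_variance_cvg_zero :
  uniform_cvg [set 0]
    (fun n lam => n%:R * b n * fine ('V_P[estimator n lam])%E)
    (fun lam => 2 * spectral_density C lam ^+ 2 * k2).
Proof.
have tb0 : 0 < k2 + 1 by rewrite ltr_wpDl.
have Ttb (x : R) : [set 0] x -> `|k2| <= k2 + 1.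
  by move=> _; rewrite ger0_norm// lerDl.
have AL (x : R) : [set 0]  x -> `|x| <= 0 by move=> ->; rewrite normr0.
apply: (scaled_variance_uniform_cvg AL tb0 Ttb) => e e0.
move: (kernel_square_cvg e0); apply: filterS => n H1 lam ->.
have := H1 0 I; congr (`|_ * _ - _| <= _).
apply: eq_bigr => i _; apply: eq_bigr => j _.
by rewrite mul0r mulr0 cos0 expr1n mulr1.
Qed.

Lemma variance_estimator_fin_num n lam : ('V_P[estimator n lam])%E \is a fin_num.
Proof.
by rewrite /estimator (variance_estimator X_wss X_cov X_m4 X_M4)//; case: K_kernel.
Qed.

Lemma kernel_energy_fin_num : (\int[mu]_x (K x ^+ 2)%:E)%E = k2%:E.
Proof. by rewrite fineK//; case: K_kernel => _ _ Ki _ _; exact: integrable_fin_num. Qed.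

Lemma scaled_variance_cvg lam e : 0 < e -> \forall n \near \oo,
  `|n%:R * b n * fine ('V_P[estimator n lam])%E -
    (1 + (lam == 0)%:R) * spectral_density C lam ^+ 2 * k2| <= e.
Proof.
move=> e0; have [->|lam0] := eqVneq lam 0.
  by apply: filterS (scaled_variance_cvg_zero e0) => n; exact.
have x00 : 0 < `|lam| by rewrite normr_gt0.
have := scaled_variance_cvg_away `|lam| x00 e0.
by apply: filterS => n /(_ lam); rewrite addr0 mul1r; apply; rewrite /= !lexx.
Qed.

End SpectralEstimator.

Theorem theorem2 (d : measure_display) (T : measurableType d) (R : realType)
    (P : probability T R) (X : R -> {RV P >-> R}) (C : R -> R)
    (K : R -> R) (b rho : nat -> R)
    (M4 : R -> R -> R -> R) (g1 g2 g3 : R -> R)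
    (X_mean0 : zero_mean X)
    (X_msc : mean_square_continuous X)
    (X_wss : wide_sense_stationary X)
    (X_cov : covariance_function X C)
    (b_gt0 : forall n, 0 < b n)
    (rho_gt0 : forall n, 0 < rho n)
    (h0_int : (@lebesgue_measure R).-integrable setT (tail_sup C))
    (K_kernel : covariance_averaging_kernel K)
    (b_cvg0 : b n @[n --> \oo] --> (0 : R))
    (nb_cvgy : (n%:R * b n) @[n --> \oo] --> +oo)
    (rho_cvgy : rho n @[n --> \oo] --> +oo)
    (rhob_cvg0 : (rho n * b n) @[n --> \oo] --> (0 : R))
    (X_m4 : forall t, ('E_P[fun w => (`|X t w| ^+ 4)%R] < +oo)%E)
    (X_M4 : fourth_moment_function X M4)
    (g1_maj : cumulant_majorant g1)
    (g2_maj : cumulant_majorant g2)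
    (g3_maj : cumulant_majorant g3)
    (Q_bound : forall v1 v2 v3,
       `|cumulant4 C M4 v1 v2 v3| <= g1 v1 * g2 v2 * g3 v3) :
  let phihat n lam := spectral_estimator X K (rho n) (b n) n lam in
  let scaled_var n lam := ((n%:R * b n)%:E * 'V_P[phihat n lam])%E in
  let limit lam :=
    ((((1 + (lam == 0)%:R) * spectral_density C lam ^+ 2)%:E) *
     \int[@lebesgue_measure R]_x ((K x ^+ 2)%R)%:E)%E in
  [/\ forall lam : R, scaled_var n lam @[n --> \oo] --> limit lam,
      forall x y : R, x <= y -> ~ (x <= 0 <= y) ->
        forall e : R, 0 < e -> \forall n \near \oo,
          forall lam : R, x <= lam <= y ->
            (`|scaled_var n lam - limit lam| < e%:E)%E
    & forall lam : R, 'V_P[phihat n lam]%E @[n --> \oo] --> 0%E].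
Proof.
move=> phihat scaled_var limit.
set k2 := \int[@lebesgue_measure R]_x (K x ^+ 2).
pose v n lam : R := n%:R * b n * fine ('V_P[phihat n lam])%E.
pose l lam : R := (1 + (lam == 0)%:R) * spectral_density C lam ^+ 2 * k2.
have vE n lam : scaled_var n lam = (v n lam)%:E.
  rewrite /scaled_var /v [RHS]EFinM fineK//.
  exact: (variance_estimator_fin_num X_wss X_cov).
have lE lam : limit lam = (l lam)%:E.
  by rewrite /limit (kernel_energy_fin_num K_kernel).
have vl lam e : 0 < e -> \forall n \near \oo, `|v n lam - l lam| <= e.
  exact: (scaled_variance_cvg X_msc X_wss X_cov b_gt0 rho_gt0 h0_int K_kernel
    b_cvg0 nb_cvgy rho_cvgy rhob_cvg0 X_m4 X_M4 g1_maj g2_maj g3_maj Q_bound).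
split=> [lam|x y xy nz e e0|lam].
- rewrite lE; apply: cvg_EFin; first by apply: nearW => n; rewrite vE.
  apply/cvgrPdist_le => e e0; apply: filterS (vl lam e e0) => n.
  by rewrite /= vE distrC.
- have e20 : 0 < e / 2 by rewrite divr_gt0.
  pose x0 := Num.min `|x| `|y|; pose Lam := Num.max `|x| `|y|.
  have sgn : 0 < x \/ y < 0.
    case: (ltP 0 x) => [|x0']; [by left|right].
    by rewrite ltNge; apply/negP => y0; apply: nz; rewrite x0' y0.
  have x00 : 0 < x0.
    rewrite /x0 lt_min !normr_gt0; case: sgn => h.
      by rewrite !gt_eqF//; exact: lt_le_trans h xy.
    by rewrite !lt_eqF//; exact: le_lt_trans xy h.
  have := scaled_variance_cvg_away X_msc X_wss X_cov b_gt0 rho_gt0 h0_int K_kernel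
    b_cvg0 nb_cvgy rho_cvgy rhob_cvg0 X_m4 X_M4 g1_maj g2_maj g3_maj Q_bound
    Lam x00 e20.
  apply: filterS => n H lam /andP[xl ly].
  have lam_in : x0 <= `|lam| <= Lam.
    rewrite /x0 /Lam ge_min le_max.
    case: sgn => h.
      have x0' := ltW h; have l0 := le_trans x0' xl; have y0 := le_trans l0 ly.
      by rewrite !ger0_norm// xl ly orbT.
    have y0 := ltW h; have l0 := le_trans ly y0; have x0' := le_trans xl l0.
    by rewrite !ler0_norm// !lerN2 xl ly orbT.
  have lam0 : lam != 0.
    by rewrite -normr_gt0; apply: lt_le_trans x00 _; case/andP: lam_in.
  rewrite vE lE -EFinB /= lte_fin.
  have := H lam lam_in; rewrite /l (negbTE lam0) addr0 mul1r -/(v n lam) -/k2 => H'.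
  by apply: le_lt_trans H' _; lra.
- apply: cvg_EFin.
    by apply: nearW => n; exact: (variance_estimator_fin_num X_wss X_cov).
  apply/cvgrPdist_le => e e0.
  have c0 : 0 < (`|l lam| + 1) / e by rewrite divr_gt0// ltr_wpDl.
  have big := near_ge_of_cvgy ((`|l lam| + 1) / e) nb_cvgy.
  move: (vl lam 1 ltr01) big; apply: filterS2 => n H1 H2.
  rewrite sub0r normrN /=.
  have nb0 : 0 < n%:R * b n by exact: lt_le_trans H2.
  rewrite -(ler_pM2l nb0) -{1}(gtr0_norm nb0) -normrM -/(v n lam).
  apply: (@le_trans _ _ (`|l lam| + 1)).
    rewrite -[v n lam](subrK (l lam)) addrC.
    exact: le_trans (ler_normD _ _) (lerD (lexx _) H1).
  by move: H2; rewrite ler_pdivrMr.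
Qed.
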